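(* Let $q$ be a power of an odd prime with $q\equiv 1\pmod 4$. For any $\epsilon>0$ there exists a monic square-free polynomial $m\in\mathbb{F}_q[T]$ such that $\delta_+^{\lambda,\mathsf{nc}}(m)<\frac12+\epsilon$ and $\delta_+^{\lambda}(m)<\frac12+\epsilon$.
   Context: Let $A=\mathbb{F}_q[T]$; $m$ is understood non-constant. $\lambda$ is the Liouville function: $\lambda(f)=(-1)^{e_1+\cdots+e_k}$ if $f$ is a unit times $g_1^{e_1}\cdots g_k^{e_k}$ with distinct monic irreducible $g_i$. $\chi_m(f)=\left(\frac fm\right)$ is the quadratic (Jacobi-symbol) character modulo $m$, equal to $0$ if $\gcd(f,m)\ne1$. For $n\ge 1$ let $a_\pm^\lambda(n;m)=\#\{f\in A \text{ monic}:\deg f=n,\ \lambda(f)\chi_m(f)=\pm1\}$ and $A^\lambda_\pm(n;m)=\sum_{k=1}^n a^\lambda_\pm(k;m)$. The densities are $$\delta_+^{\lambda,\mathsf{nc}}(m)=\lim_{n\to\infty}\frac{\#\{1\le k\le n: a_+^\lambda(k;m)>a_-^\lambda(k;m)\}}{n},\quad \delta_+^{\lambda}(m)=\lim_{n\to\infty}\frac{\#\{1\le k\le n: A_+^\lambda(k;m)>A_-^\lambda(k;m)\}}{n},$$ and the assertion includes that these limits exist for the chosen $m$. *)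

(* Defs.v *)
From HB Require Import structures.
From mathcomp Require Import all_boot all_order all_algebra.
From mathcomp Require Import all_classical all_reals all_analysis.
Set Implicit Arguments.
Unset Strict Implicit.
Unset Printing Implicit Defensive.
Import Order.TTheory GRing.Theory Num.Theory.
Import numFieldNormedType.Exports.
Local Open Scope ring_scope.

(* The exponent of P in f. For size P > 1 and f != 0, P ^+ n %| f forces
   n < size f, so the bound loses nothing. *)
Definition multp (F : fieldType) (P f : {poly F}) : nat :=
  (\max_(n < (size f).+1 | (P ^+ n %| f)%R) n)%N.

Definition monic_irred (F : finFieldType) (P : {poly F}) : bool :=
  (P \is monic) && irreducibleb P.

(* Every irreducible divisor of f != 0 has size at most size f, so it occurs
   in the finite type {poly_(size f) F}; the other monic irreducible
   polynomials contribute exponent 0. *)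
Definition big_omega (F : finFieldType) (f : {poly F}) : nat :=
  (\sum_(P : {poly_(size f) F} | monic_irred (polyn P)) multp (polyn P) f)%N.

Definition liouville (F : finFieldType) (f : {poly F}) : int :=
  (-1) ^+ big_omega f.

(* The residue symbol (f / P) for P irreducible; the polynomials of size at
   most size P include representatives of all residue classes modulo P. *)
Definition legendre (F : finFieldType) (f P : {poly F}) : int :=
  if P %| f then 0
  else if [exists g : {poly_(size P) F}, P %| f - polyn g ^+ 2] then 1
  else -1.

Definition jacobi (F : finFieldType) (f m : {poly F}) : int :=
  \prod_(P : {poly_(size m) F} | monic_irred (polyn P))
    legendre f (polyn P) ^+ multp (polyn P) m.

(* The sign s is 1 or -1; {poly_(n.+1) F} is the finite type of polynomials
   of degree at most n. *)
Definition a_lambda (F : finFieldType) (s : int) (n : nat) (m : {poly F}) :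
    nat :=
  #|[set f : {poly_(n.+1) F} |
      [&& polyn f \is monic, size (polyn f) == n.+1
        & liouville (polyn f) * jacobi (polyn f) m == s]]|.

Definition A_lambda (F : finFieldType) (s : int) (n : nat) (m : {poly F}) :
    nat :=
  (\sum_(1 <= k < n.+1) a_lambda s k m)%N.

Definition square_free (F : fieldType) (m : {poly F}) : Prop :=
  m != 0 /\ forall u : {poly F}, size u != 1%N -> ~~ (u ^+ 2 %| m).

(* The limit defining the natural density of {k >= 1 | E k} exists and is d. *)
Definition has_density (R : realType) (E : nat -> bool) (d : R) : Prop :=
  ((fun n : nat => (count E (iota 1 n))%:R / n%:R : R) @ \oo --> d)%classic.

Definition has_delta_plus_nc (R : realType) (F : finFieldType) (m : {poly F})
    (d : R) : Prop :=
  has_density (fun k => (a_lambda (-1) k m < a_lambda 1 k m)%N) d.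

Definition has_delta_plus (R : realType) (F : finFieldType) (m : {poly F})
    (d : R) : Prop :=
  has_density (fun k => (A_lambda (-1) k m < A_lambda 1 k m)%N) d.

(* Main.v *)
(** Take m = T^q + T.  Over an extension L of F_q in which enough polynomials split,
the residue symbol of f modulo m is the quadratic character of the product of f(w) over
the roots w of m; hence the symbol of the minimal polynomial of x is the quadratic
character of x^q + x, and the generating series of lambda * chi_m is governed, through
Newton's identities, by the character sums of x^q + x over the fields F_(q^j).  For odd j
they vanish.  For j = 2i they reduce to counting the isotropic vectors of a quadratic form
on F_(q^j), which amounts to the norm form of F_(q^j) / F_(q^i) if i is even and to a
hyperbolic form if i is odd.  With k = (q - 1) / 2 this says
sum_n (a_+ - a_-)(n) u^n = (1 - v) (1 - v^2)^k / ((1 - q v) (1 + q v)^k), where v = u^2.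
The pole at v = - 1/q dominates because k >= 2; at the level of the logarithmic derivative
this means that, after v is replaced by -v, all its coefficients are positive, both for
this series and for its quotient by 1 - v, whose coefficients are the partial sums.  So the
coefficients of both alternate in sign, and the two densities are 1/4 and 1/2. *)
Require Import Defs.
From HB Require Import structures.
From mathcomp Require Import all_boot all_order all_algebra all_field.
From mathcomp Require Import all_classical all_reals all_analysis.
From mathcomp Require Import qpoly ring lra zify.
Set Implicit Arguments.
Unset Strict Implicit.
Unset Printing Implicit Defensive.
Import Order.TTheory GRing.Theory Num.Theory.
Local Open Scope ring_scope.

(** * Finite extensions and minimal polynomials *)

Definition splits (L : fieldType) (p : {poly L}) : Prop :=
  exists s : seq L, p %= \prod_(x <- s) ('X - x%:P).

Lemma splits_dvdp (L : fieldType) (p r : {poly L}) :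
  r %| p -> splits p -> splits r.
Proof.
move=> r_p [s ps]; move: r_p; rewrite (eqp_dvdr _ ps) => /dvdp_prod_XsubC[m rm].
by exists (mask m s).
Qed.

(** A splitting field of the product of all nonzero polynomials of size at most [B] serves them all
    at once; [g] replaces the zero polynomial by 1 to keep the product nonzero. *)
Lemma splitting_extension (F : finFieldType) (B : nat) :
  exists (L : finFieldType) (iota : {rmorphism F -> L}),
    forall f : {poly F}, f != 0 -> (size f <= B)%N -> splits (map_poly iota f).
Proof.
pose g (f : {poly_B F}) : {poly F} := if polyn f == 0 then 1 else polyn f.
have g0 f : g f != 0 by rewrite /g; case: ifPn; rewrite ?oner_neq0.
have [L [s ps _]] := FinSplittingFieldFor (introT (prodf_neq0 _ _) (fun f _ => g0 f) : \prod_f g f != 0).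
exists (FinFieldExtType L), (in_alg L) => f f0 szf.
have : splits (map_poly (in_alg L) (\prod_f g f)) by exists s.
apply: splits_dvdp; rewrite dvdp_map (bigD1 (NPoly szf)) //= {1}/g /= (negPf f0).
exact: dvdp_mulr.
Qed.

Section FrobeniusExtension.

Variables (F L : finFieldType) (iota : {rmorphism F -> L}).
Local Notation q := #|F|.
Local Notation "f ^i" := (map_poly iota f) (at level 2, format "f ^i").

Lemma finext_pchar : [pchar L].-nat q.
Proof.
have [p pr_p ch] := finPcharP F; rewrite (card_pprimeChar ch) pnatX.
by rewrite pnatE // (fmorph_pchar iota) ch.
Qed.

Lemma frobD (j : nat) (x y : L) :
  (x + y) ^+ (q ^ j) = x ^+ (q ^ j) + y ^+ (q ^ j).
Proof. by apply: exprDn_pchar; rewrite pnatX finext_pchar. Qed.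

Lemma card_finField_gt0 : (0 < q)%N.
Proof. by apply: ltnW; exact: finNzRing_gt1. Qed.
Local Hint Resolve card_finField_gt0 : core.

Lemma frob_gt0 j : (0 < q ^ j)%N.
Proof. by rewrite expn_gt0 card_finField_gt0. Qed.

Lemma frobN (j : nat) (x : L) : (- x) ^+ (q ^ j) = - x ^+ (q ^ j).
Proof.
apply/eqP; rewrite -subr_eq0 opprK -frobD addNr expr0n.
by rewrite (gtn_eqF (frob_gt0 j)).
Qed.

Lemma frobB (j : nat) (x y : L) :
  (x - y) ^+ (q ^ j) = x ^+ (q ^ j) - y ^+ (q ^ j).
Proof. by rewrite frobD frobN. Qed.

Lemma frob_sum (j : nat) (I : Type) (r : seq I) (P : pred I) (E : I -> L) :
  (\sum_(i <- r | P i) E i) ^+ (q ^ j) = \sum_(i <- r | P i) E i ^+ (q ^ j).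
Proof.
elim/big_rec2: _ => [|i y z _ <-]; last by rewrite frobD.
by rewrite expr0n (gtn_eqF (frob_gt0 j)).
Qed.

(* The argument carries the embedding on which the morphism structure below depends. *)
Definition frobenius of {rmorphism F -> L} := fun x : L => x ^+ q.
Local Notation frob := (frobenius iota).
Local Notation ord := (fingraph.order frob).
Local Notation orb := (fingraph.orbit frob).

Lemma iter_frob j x : iter j frob x = x ^+ (q ^ j).
Proof. by elim: j => [|j IH]; rewrite ?expr1 //= IH /frobenius -exprM expnSr. Qed.

Lemma frob_inj : injective frob.
Proof.
move=> x y /eqP; rewrite /frobenius -subr_eq0 -[q]expn1 -frobB expf_eq0 => /andP[_].
by rewrite subr_eq0 => /eqP.
Qed.

Lemma frob_iota (a : F) j : iota a ^+ (q ^ j) = iota a.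
Proof. by rewrite -iter_frob; elim: j => //= j ->; rewrite /frobenius -rmorphXn expf_card. Qed.

(** T^q - T is the product of all T - a with a in [F], so its roots in [L] lie in the image of
    [iota]. *)
Lemma frob_fixed (x : L) : x ^+ q = x -> exists a, iota a = x.
Proof.
move=> xq; have : root ('X^q - 'X : {poly F})^i x.
  by rewrite rmorphB /= map_polyXn map_polyX rootE !hornerE xq subrr.
rewrite finField_genPoly rmorph_prod /=.
under eq_bigr do rewrite map_polyXsubC.
rewrite -(big_image _ _ iota (fun=> true) (fun a => 'X - a%:P)) root_prod_XsubC.
by case/mapP=> a _ ->; exists a.
Qed.

Lemma frob_horner (f : {poly F}) x j : f^i.[x ^+ (q ^ j)] = f^i.[x] ^+ (q ^ j).
Proof.
rewrite !horner_coef frob_sum; apply: eq_bigr => i _.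
by rewrite exprMn -!exprM mulnC coef_map frob_iota.
Qed.

Fact frob_zmod_morphism : zmod_morphism frob.
Proof. by move=> x y; rewrite /frobenius -[q]expn1 frobB. Qed.

Fact frob_monoid_morphism : monoid_morphism frob.
Proof. by split=> [|x y]; rewrite /frobenius ?expr1n ?exprMn. Qed.

HB.instance Definition _ :=
  GRing.isZmodMorphism.Build L L frob frob_zmod_morphism.
HB.instance Definition _ :=
  GRing.isMonoidMorphism.Build L L frob frob_monoid_morphism.

Definition finext_inv (x : L) : F :=
  if [pick a | iota a == x] is Some a then a else 0.

Lemma finext_invK (x : L) : x ^+ q = x -> iota (finext_inv x) = x.
Proof.
move=> /frob_fixed[b bx]; rewrite /finext_inv; case: pickP => [a /eqP //|/= no].
by have := no b; rewrite bx eqxx.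
Qed.

Lemma frob_descent (g : {poly L}) :
  map_poly frob g = g -> (map_poly finext_inv g)^i = g.
Proof.
have h0 : finext_inv 0 = 0.
  by apply: (fmorph_inj iota); rewrite finext_invK ?rmorph0 ?expr0n ?gtn_eqF.
move=> fg; apply/polyP => j; rewrite coef_map coef_map_id0 //= finext_invK //.
by rewrite -[in RHS]fg coef_map.
Qed.

(** For j > 0 this models the field of q^j elements inside [L]; it has that many elements only if
    [L] is large enough, see [card_Fix]. *)
Definition frob_fix (j : nat) : {set L} := [set x | x ^+ (q ^ j) == x].
Local Notation Fix := frob_fix.

Lemma FixP j x : reflect (x ^+ (q ^ j) = x) (x \in Fix j).
Proof. by rewrite inE; apply: eqP. Qed.

Lemma card_roots (p : {poly L}) :
  splits p -> separable_poly p -> #|[set x | root p x]| = (size p).-1.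
Proof.
case=> s ps; rewrite (eqp_separable ps) separable_prod_XsubC => us.
rewrite (eqp_size ps) size_prod_XsubC /= -(card_uniqP us).
by apply: eq_card => x; rewrite inE (eqp_root ps) root_prod_XsubC.
Qed.

Lemma natq0 : q%:R = 0 :> L.
Proof.
have [p pr_p chF] := finPcharP F; have /andP[_ /eqP p0] := chF.
have qp := card_pprimeChar chF; rewrite -(rmorph_nat iota) qp.
case: (logn _ _) qp => [q1|n _]; first by have := finNzRing_gt1 F; rewrite q1.
by rewrite expnS natrM p0 mul0r rmorph0.
Qed.

(** The derivative is the nonzero constant [a], since q vanishes in [L]. *)
Lemma separable_XqaX (j : nat) (a : L) : (0 < j)%N -> a != 0 ->
  separable_poly ('X^(q ^ j) + a *: 'X : {poly L}).
Proof.
move=> j0 a0; rewrite separable_poly.unlock derivD derivXn derivZ derivX.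
rewrite -(prednK j0) -mulr_natr expnS -polyC_natr natrM natq0 mul0r mulr0 add0r.
by rewrite coprimepZr ?coprimep1.
Qed.

Variable B : nat.
Hypothesis splitB : forall f : {poly F}, f != 0 -> (size f <= B)%N -> splits f^i.

Lemma size_XqaX (R : idomainType) (j : nat) (a : R) : (0 < j)%N ->
  size ('X^(q ^ j) + a *: 'X : {poly R}) = (q ^ j).+1.
Proof.
move=> j0; rewrite size_polyDl size_polyXn // ltnS.
apply: leq_trans (size_scale_leq _ _) _; rewrite size_polyX.
by rewrite (leq_trans (finNzRing_gt1 F)) // -{1}[q]expn1 leq_exp2l ?finNzRing_gt1.
Qed.

Lemma card_root_XqaX (j : nat) (a : F) : (0 < j)%N -> (q ^ j < B)%N -> a != 0 ->
  #|[set x : L | x ^+ (q ^ j) + iota a * x == 0]| = (q ^ j)%N.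
Proof.
move=> j0 jB a0; set f : {poly F} := 'X^(q ^ j) + a *: 'X.
have szf : size f = (q ^ j).+1 by exact: size_XqaX.
have f0 : f != 0 by rewrite -size_poly_eq0 szf.
have fi : f^i = 'X^(q ^ j) + iota a *: 'X.
  by rewrite rmorphD /= map_polyXn map_polyZ map_polyX.
have := card_roots (splitB f0 _); rewrite szf fi => /(_ jB).
rewrite size_XqaX //= separable_XqaX ?fmorph_eq0 // => /(_ isT) cf.
rewrite -[RHS]cf.
by apply: eq_card => x; rewrite !inE rootE !hornerE.
Qed.

Lemma card_Fix (j : nat) : (0 < j)%N -> (q ^ j < B)%N -> #|Fix j| = (q ^ j)%N.
Proof.
move=> j0 jB; rewrite -(@card_root_XqaX j (-1)) ?oppr_eq0 ?oner_eq0 //.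
by apply: eq_card => x; rewrite !inE rmorphN1 mulN1r subr_eq0.
Qed.

Lemma order_frob_dvd x j : (ord x %| j)%N = (x \in Fix j).
Proof.
rewrite inE -iter_frob.
have it k : iter (k * ord x) frob x = x.
  by elim: k => //= k IH; rewrite mulSn iterD IH (iter_order frob_inj).
apply/idP/eqP => [/dvdnP[k ->] //|]; rewrite {1}(divn_eq j (ord x)) addnC.
rewrite iterD it => e; rewrite /dvdn; have := ltn_pmod j (fingraph.order_gt0 frob x).
by move/(@findex_iter _ frob); rewrite e findex0 => <-.
Qed.

Definition conj_poly x : {poly L} := \prod_(z <- orb x) ('X - z%:P).
Definition min_poly x : {poly F} := map_poly finext_inv (conj_poly x).

(** Frobenius permutes the orbit of [x], hence fixes the coefficients of [conj_poly x], which
    therefore descend to [F]. *)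
Lemma min_polyE x : (min_poly x)^i = conj_poly x.
Proof.
apply: frob_descent; rewrite /conj_poly rmorph_prod /=.
under eq_bigr do rewrite map_polyXsubC.
rewrite -(big_map frob predT (fun z => 'X - z%:P)); apply: perm_big.
apply: uniq_perm; rewrite ?fingraph.orbit_uniq ?(map_inj_uniq frob_inj) ?fingraph.orbit_uniq //.
have sub : {subset map frob (orb x) <= orb x}.
  by move=> _ /mapP[z zx ->]; rewrite fingraph.mem_orbit.
have [||_ e] := uniq_min_size _ sub; last exact: e.
  by rewrite (map_inj_uniq frob_inj) fingraph.orbit_uniq.
by rewrite size_map.
Qed.

Lemma min_poly_monic x : min_poly x \is monic.
Proof. by rewrite -(map_monic iota) min_polyE monic_prod_XsubC. Qed.

Lemma min_poly_neq0 x : min_poly x != 0.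
Proof. exact: monic_neq0 (min_poly_monic x). Qed.

Lemma size_min_poly x : size (min_poly x) = (ord x).+1.
Proof. by rewrite -(size_map_poly iota) min_polyE size_prod_XsubC size_orbit. Qed.

Lemma root_min_poly x y : root (min_poly x)^i y = (y \in orb x).
Proof. by rewrite min_polyE root_prod_XsubC. Qed.

(** The roots of a polynomial over [F] are stable under Frobenius, so a root [x] brings its whole
    orbit, whose members are distinct. *)
Lemma min_poly_dvdP (f : {poly F}) x : root f^i x = (min_poly x %| f).
Proof.
apply/idP/idP => [fx|]; last first.
  rewrite -(dvdp_map iota) => /dvdpP[g ->].
  by rewrite rootM root_min_poly fingraph.in_orbit orbT.
rewrite -(dvdp_map iota) min_polyE uniq_roots_dvdp ?uniq_rootsE ?fingraph.orbit_uniq //.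
apply/allP => y; rewrite -fconnect_orbit => /iter_findex <-.
by rewrite rootE iter_frob frob_horner (eqP fx) expr0n gtn_eqF ?frob_gt0.
Qed.

(** The roots of [min_poly x] are simple, so dividing by it lowers the multiplicity of [x] by
    exactly one. *)
Lemma min_poly_expn_dvd (f : {poly F}) x k : f != 0 ->
  (min_poly x ^+ k %| f) = (k <= mup x f^i)%N.
Proof.
elim: k f => [|k IH] f f0; first by rewrite dvd1p.
have fi0 : f^i != 0 by rewrite map_poly_eq0.
have [fx|nfx] := boolP (root f^i x); last first.
  rewrite (mupNroot nfx) ltn0; apply: contraNF nfx => /(dvdp_trans _) H.
  by rewrite min_poly_dvdP H // exprS dvdp_mulr.
move: (fx); rewrite min_poly_dvdP => /dvdpP[g fE].
have g0 : g != 0 by apply: contraNneq f0 => g0; rewrite fE g0 mul0r.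
rewrite fE exprSr dvdp_mul2r ?min_poly_neq0 // IH // rmorphM /=.
rewrite mupM ?map_poly_eq0 ?min_poly_neq0 // min_polyE mu_prod_XsubC.
by rewrite count_uniq_mem ?fingraph.orbit_uniq // fingraph.in_orbit addn1.
Qed.

(** A nonconstant divisor has a root in the orbit of [x], hence also the root [x], and so is a
    multiple of [min_poly x]. *)
Lemma min_poly_irreducible x : irreducible_poly (min_poly x).
Proof.
split=> [|g sg gP]; first by rewrite size_min_poly ltnS fingraph.order_gt0.
rewrite -dvdp_size_eqp // eqn_leq dvdp_leq ?min_poly_neq0 //=.
rewrite dvdp_leq ?(dvdpN0 gP) ?min_poly_neq0 //.
have: g^i %| conj_poly x by rewrite -min_polyE dvdp_map.
case/dvdp_prod_XsubC=> m gm; case sE: (mask m (orb x)) gm => [|y s] gm.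
  by move: sg; rewrite -(size_map_poly iota) (eqp_size gm) big_nil size_poly1.
have gy : root g^i y by rewrite (eqp_root gm) root_prod_XsubC inE eqxx.
have : y \in orb x by apply: (@mem_mask _ _ m); rewrite sE inE eqxx.
rewrite -fconnect_orbit (fconnect_sym frob_inj) => /iter_findex yx.
rewrite -min_poly_dvdP -yx iter_frob rootE frob_horner (eqP gy) expr0n.
by rewrite gtn_eqF // frob_gt0.
Qed.

Lemma sum_mup (f : {poly F}) : f != 0 -> splits f^i ->
  (\sum_x mup x f^i)%N = (size f).-1.
Proof.
move=> f0 [s fs]; rewrite -(size_map_poly iota) (eqp_size fs) size_prod_XsubC /=.
have f0i : f^i != 0 by rewrite map_poly_eq0.
have -> : size s = (\sum_x count_mem x s)%N.
  elim: (s) => [|y t IH] /=; first by rewrite big1.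
  rewrite big_split /= -IH (bigD1 y) //= eqxx big1 // => x /negPf.
  by rewrite eq_sym => ->.
apply: eq_bigr => x _; rewrite -mu_prod_XsubC.
apply/eqP; rewrite eqn_leq.
have g0 : \prod_(y <- s) ('X - y%:P) != 0 by rewrite monic_neq0 ?monic_prod_XsubC.
by rewrite !mup_geq // -(eqp_dvdr _ fs) -mup_geq // leqnn (eqp_dvdr _ fs) -mup_geq ?leqnn.
Qed.

End FrobeniusExtension.

(** * Newton's identities for completely multiplicative functions *)

Definition monic_deg (F : fieldType) (n : nat) (f : {poly F}) : bool :=
  (f \is monic) && (size f == n.+1).

Lemma monic_degM (F : fieldType) (g h : {poly F}) j n :
  monic_deg j g -> (j <= n)%N -> monic_deg (n - j) h = monic_deg n (g * h).
Proof.
case/andP=> mg /eqP sg jn; rewrite /monic_deg monicMl //.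
have [->|h0] := eqVneq h 0; first by rewrite monicE lead_coef0 eq_sym oner_eq0.
rewrite size_mul ?(monic_neq0 mg) // sg addSn /=; congr (_ && _).
by apply/eqP/eqP; move: (size h) => m; lia.
Qed.

Section Newton.

Variables (F : finFieldType) (X : {poly F} -> int).
Hypothesis XM : forall f g : {poly F}, f != 0 -> g != 0 -> X (f * g) = X f * X g.

Definition monic_sum (n : nat) : int :=
  \sum_(f : {poly_(n.+1) F} | monic_deg n (polyn f)) X (polyn f).

(** Substitute f = g h; [up] and [dn] are the two directions of this bijection, and the degrees
    ensure that [npolyp] truncates nothing. *)
Lemma monic_sum_dvd (g : {poly F}) (j n : nat) :
  monic_deg j g -> (j <= n)%N ->
  \sum_(f : {poly_(n.+1) F} | monic_deg n (polyn f) && (g %| polyn f)) X (polyn f)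
    = X g * monic_sum (n - j).
Proof.
move=> mdg jn; have [mg sg] := andP mdg; have g0 := monic_neq0 mg.
pose up (h : {poly_((n - j).+1) F}) : {poly_(n.+1) F} := npolyp n.+1 (g * polyn h).
pose dn (f : {poly_(n.+1) F}) := npolyp (n - j).+1 (polyn f %/ g).
have upE h : polyn (up h) = g * polyn h.
  rewrite npolypK //; apply: leq_trans (size_polyMleq _ _) _.
  by rewrite (eqP sg) addSn /=; move: (size _) (size_npoly h) => m; lia.
have dnE f : polyn (dn f) = polyn f %/ g.
  rewrite npolypK // size_divp // (eqP sg) /=; move: (size _) (size_npoly f) => m; lia.
rewrite (reindex_onto up dn) => [|f /andP[_ gf]]; last first.
  by apply: val_inj; rewrite /= upE dnE mulrC divpK.
rewrite mulr_sumr; apply: eq_big => [h|h /andP[/andP[mh _] _]]; last first.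
  rewrite upE XM //; move: mh; rewrite upE -(monic_degM _ mdg jn) // => /andP[mh _].
  exact: monic_neq0.
rewrite upE -(monic_degM _ mdg jn) // dvdp_mulr // andbT.
suff -> : dn (up h) == h by rewrite andbT.
by apply/eqP/val_inj; rewrite /= dnE upE mulrC mulpK.
Qed.

Lemma monic_sum0 : X 1 = 1 -> monic_sum 0 = 1.
Proof.
move=> x1; have sz1 : (size (1%R : {poly F}) <= 1)%N by rewrite size_poly1.
rewrite /monic_sum (bigD1 (NPoly sz1)) /=; last first.
  by rewrite /monic_deg monic1 size_poly1.
rewrite x1 big1 ?addr0 // => f /andP[/andP[mf /eqP/eqP/size_poly1P[c c0 fc]]].
have f1 : polyn f = 1 by move: mf; rewrite fc monicE lead_coefC => /eqP ->.
by case/eqP; apply: val_inj.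
Qed.

Lemma multiplicative_at1 g : g != 0 -> X g != 0 -> X 1 = 1.
Proof. by move=> g0 Xg; apply: (mulfI Xg); rewrite -XM ?oner_eq0 // !mulr1. Qed.

Lemma multiplicative_exp g k : g != 0 -> X 1 = 1 -> X (g ^+ k) = X g ^+ k.
Proof.
move=> g0 x1; elim: k => // k IH; rewrite !exprS XM ?IH // expf_neq0 //.
Qed.

Variables (L : finFieldType) (iota : {rmorphism F -> L}).
Local Notation frob := (frobenius iota).
Local Notation ord := (fingraph.order frob).

(** Applied with d the degree of a root x of f and m its multiplicity, where the minimum is m. *)
Lemma count_multiples (d m n : nat) : (0 < d)%N ->
  (\sum_(1 <= j < n.+1) ((d %| j)%N && (j %/ d <= m)%N : nat))%N = minn m (n %/ d).
Proof.
move=> d0; elim: n => [|n IH]; first by rewrite big_nil div0n minn0.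
rewrite big_nat_recr //= IH (divnS n d0).
by case: (d %| n.+1)%N => /=; lia.
Qed.

(** In a large enough [L], each monic irreducible P of degree d dividing j contributes d X(P)^(j/d),
    once per root. These are the coefficients of the logarithmic derivative of the generating series
    of [monic_sum]. *)
Definition prime_power_sum (j : nat) : int :=
  \sum_(x in frob_fix F L j) X (min_poly iota x) ^+ (j %/ ord x).

Lemma monic_deg_min_poly x k : monic_deg (ord x * k) (min_poly iota x ^+ k).
Proof.
have mp := min_poly_monic iota x; rewrite /monic_deg monic_exp //=.
have := size_exp (min_poly iota x) k; rewrite size_min_poly /= => <-.
by rewrite prednK // size_poly_gt0 expf_neq0 // monic_neq0.
Qed.

(* Each monic f of degree n satisfies n = #{(j, x) : x in F_(q^j), P^(j / deg P) | f},
   where P is the minimal polynomial of x; weight this by X f and sum over f. *)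
Lemma newton (n : nat) : X 1 = 1 ->
  (forall f : {poly F}, f != 0 -> (size f <= n.+1)%N -> splits (map_poly iota f)) ->
  n%:Z * monic_sum n =
    \sum_(1 <= j < n.+1) prime_power_sum j * monic_sum (n - j).
Proof.
move=> x1 splitn; have ord0 x : (0 < ord x)%N by rewrite fingraph.order_gt0.
have nE (f : {poly F}) : monic_deg n f ->
    n = (\sum_(1 <= j < n.+1) \sum_(x in frob_fix F L j)
      ((min_poly iota x ^+ (j %/ ord x))%R %| f)%R)%N.
  case/andP=> mf /eqP sf; have f0 := monic_neq0 mf.
  transitivity (size f).-1; first by rewrite sf.
  rewrite -(sum_mup f0 (splitn _ f0 _)) ?sf //= (exchange_big_dep predT) //=.
  apply: eq_bigr => x _.
  (* By this degree bound the cutoff j <= n loses none of the powers of the minimal polynomial that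
     divide f. *)
  have mE : (ord x * mup x (map_poly iota f) <= n)%N.
    have : min_poly iota x ^+ mup x (map_poly iota f) %| f.
      by rewrite min_poly_expn_dvd.
    have /andP[_ /eqP sP] := monic_deg_min_poly x (mup x (map_poly iota f)).
    by move/(dvdp_leq f0); rewrite sP sf ltnS.
  transitivity (minn (mup x (map_poly iota f)) (n %/ ord x)).
    by symmetry; apply/minn_idPl; rewrite leq_divRL // mulnC.
  rewrite -count_multiples // [RHS]big_mkcond /=; apply: eq_bigr => j _.
  rewrite -(order_frob_dvd iota); case: (_ %| _)%N => //=.
  by rewrite min_poly_expn_dvd.
rewrite -natz mulr_sumr.
under eq_bigr => f mf.
  rewrite {1}(nE _ mf) natr_sum mulr_suml.
  under eq_bigr do rewrite natr_sum mulr_suml.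
  over.
rewrite exchange_big /=; apply: eq_big_nat => j /andP[j0 jn].
rewrite exchange_big /= mulr_suml; apply: eq_bigr => x xj.
have dE : (ord x * (j %/ ord x) = j)%N by rewrite mulnC divnK // order_frob_dvd.
have := monic_deg_min_poly x (j %/ ord x); rewrite dE => md.
rewrite -(multiplicative_exp _ _ x1) ?min_poly_neq0 // -monic_sum_dvd // [RHS]big_mkcondr /=.
apply: eq_bigr => f _; case: (_ %| _); first by rewrite mul1r.
by rewrite mul0r.
Qed.

End Newton.

(** * The quadratic character *)

Section Euler.

Variables (F L : finFieldType) (iota : {rmorphism F -> L}).
Local Notation q := #|F|.
Local Notation Fix := (frob_fix F L).

Hypothesis q_odd : odd q.

Definition half_order (j : nat) : nat := (q ^ j).-1./2.

(** Euler's criterion serves as the definition. It is meaningful for [z] in the field of q^j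
    elements; elsewhere -1 is a default value. *)
Definition quad_char (j : nat) (z : L) : int :=
  if z == 0 then 0 else if z ^+ half_order j == 1 then 1 else -1.

Lemma half_orderE j : (half_order j).*2 = (q ^ j).-1.
Proof.
rewrite even_halfK // -subn1 oddB ?expn_gt0 ?card_finField_gt0 //.
by rewrite oddX q_odd orbT.
Qed.

Lemma half_order_gt0 j : (0 < j)%N -> (0 < half_order j)%N.
Proof.
move=> j0; rewrite -double_gt0 half_orderE -ltnS prednK ?frob_gt0 //.
by rewrite -{1}(expn0 q) ltn_exp2l ?finNzRing_gt1.
Qed.

Lemma oner_neqN1 : 1 != -1 :> L.
Proof.
rewrite -subr_eq0 opprK; apply/negP => /eqP two0.
have := natq0 iota; rewrite -(odd_double_half q) q_odd natrD -mul2n natrM.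
by rewrite [2%:R]two0 mul0r addr0 => /eqP; rewrite oner_eq0.
Qed.

Lemma oppr_neq (y : L) : y != 0 -> - y != y.
Proof.
move=> y0; apply: contraNneq oner_neqN1 => yN.
by rewrite -(inj_eq (mulIf y0)) mulN1r mul1r yN.
Qed.

(** The characteristic is odd, so identities between signs can be checked in [L], where the
    characters become powers. *)
Lemma sign_intr_inj (a b : int) : a \in [:: 0; 1; -1] -> b \in [:: 0; 1; -1] ->
  a%:~R = b%:~R :> L -> a = b.
Proof.
have o0 := oner_eq0 L; have oN := negPf oner_neqN1.
have n0 : (-1 == 0 :> L) = false by rewrite oppr_eq0.
rewrite !inE => /or3P[]/eqP-> /or3P[]/eqP-> /eqP //;
  by rewrite ?rmorphN1 ?rmorph0 ?rmorph1 ?oN ?o0 ?n0 // eq_sym ?oN ?o0 ?n0.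
Qed.

Lemma quad_char_sign j z : quad_char j z \in [:: 0; 1; -1].
Proof. by rewrite /quad_char; case: ifP => // _; case: ifP. Qed.

Lemma Fix_expr1 j z : z \in Fix j -> z != 0 -> z ^+ (q ^ j).-1 = 1.
Proof.
move=> /FixP zj z0; apply: (mulfI z0).
by rewrite -exprS prednK ?frob_gt0 // zj mulr1.
Qed.

Lemma quad_charE j z : (0 < j)%N -> z \in Fix j ->
  (quad_char j z)%:~R = z ^+ half_order j.
Proof.
move=> j0 zj; rewrite /quad_char; have [->|z0] := eqVneq z 0.
  by rewrite expr0n gtn_eqF ?half_order_gt0.
have [-> //|z1] := eqVneq (z ^+ _) 1; rewrite rmorphN1; apply/eqP.
have := Fix_expr1 zj z0; rewrite -half_orderE -muln2 exprM => /eqP.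
by rewrite sqrf_eq1 (negPf z1) /= eq_sym.
Qed.

Lemma Fix0 j : 0 \in Fix j.
Proof. by rewrite inE expr0n gtn_eqF // frob_gt0. Qed.

Lemma FixM j x y : x \in Fix j -> y \in Fix j -> x * y \in Fix j.
Proof. by move=> /FixP xj /FixP yj; rewrite inE exprMn xj yj. Qed.

Lemma FixN j x : x \in Fix j -> - x \in Fix j.
Proof. by move=> /FixP xj; rewrite inE (frobN iota) xj. Qed.

Lemma FixD j x y : x \in Fix j -> y \in Fix j -> x + y \in Fix j.
Proof. by move=> /FixP xj /FixP yj; rewrite inE (frobD iota) xj yj. Qed.

Lemma card_expr1 n : (0 < n)%N -> (#|[set z : L | z ^+ n == 1%R]| <= n)%N.
Proof.
move=> n0; rewrite cardE; apply: max_unity_roots; rewrite ?enum_uniq //.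
by apply/allP => z; rewrite mem_enum inE unity_rootE.
Qed.

Lemma sqrt2P (y z : L) : (z ^+ 2 == y ^+ 2) = (z \in [set y; - y]).
Proof. by rewrite eqf_sqr !inE. Qed.

(** Squaring is at most two-to-one, so there are at least (q^j - 1)/2 nonzero squares. They all
    satisfy an equation with at most that many roots, hence exhaust its roots. *)
Lemma Fix_squareP j z : (0 < j)%N -> #|Fix j| = (q ^ j)%N -> z \in Fix j ->
  z ^+ half_order j = 1 -> exists2 y, y \in Fix j & y ^+ 2 = z.
Proof.
move=> j0 cj zj z1; pose S := [set y ^+ 2 | y in Fix j :\ 0].
suff : z \in S.
  by case/imsetP => y; rewrite inE => /andP[_ yj] ->; exists y.
have ST : S \subset [set z | z ^+ half_order j == 1].
  apply/fintype.subsetP => _ /imsetP[y /setD1P[y0 yj] ->].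
  by rewrite inE -exprM mul2n half_orderE Fix_expr1.
suff /eqP -> : S == [set z | z ^+ half_order j == 1] by rewrite inE z1.
rewrite eqEcard ST (leq_trans (card_expr1 (half_order_gt0 j0))) //.
rewrite -leq_double half_orderE -cj (cardsD1 0) Fix0 /= -mul2n mulnC.
rewrite -sum1_card (partition_big (fun y => y ^+ 2) (mem S)) => [|y yj]; last first.
  exact: imset_f.
rewrite -sum_nat_const; apply: leq_sum => _ /imsetP[y /setD1P[y0 yj] ->].
rewrite sum1dep_card; apply: leq_trans (_ : #|[set y; - y]| <= 2)%N; last first.
  by rewrite cards2 ltnS leq_b1.
by apply/subset_leq_card/fintype.subsetP => x; rewrite inE sqrt2P => /andP[].
Qed.

Lemma card_sqrt j z : (0 < j)%N -> #|Fix j| = (q ^ j)%N -> z \in Fix j ->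
  #|[set y in Fix j | y ^+ 2 == z]|%:Z = 1 + quad_char j z.
Proof.
move=> j0 cj zj; rewrite /quad_char; have [->|z0] := eqVneq z 0.
  suff -> : [set y in Fix j | y ^+ 2 == 0] = [set 0] by rewrite cards1 addr0.
  apply/setP => y; rewrite !inE sqrf_eq0; have [->|_] := eqVneq y 0; last by rewrite andbF.
  by rewrite expr0n gtn_eqF ?frob_gt0 ?eqxx.
have [z1|z1] := eqVneq (z ^+ _) 1.
  have [y yj yz] := Fix_squareP j0 cj zj z1.
  have y0 : y != 0 by apply: contraNneq z0 => y0; rewrite -yz y0 expr0n.
  suff -> : [set y in Fix j | y ^+ 2 == z] = [set y; - y].
    by rewrite cards2 eq_sym oppr_neq.
  apply/setP => x; rewrite inE -yz sqrt2P; apply: andb_idl.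
  by case/set2P=> ->; last apply: FixN.
rewrite subrr; apply/eqP; rewrite eqz_nat cards_eq0; apply/eqP/setP => y.
rewrite !inE; apply/negP => /andP[yj /eqP yz]; case/eqP: z1.
rewrite -yz -exprM mul2n half_orderE Fix_expr1 ?inE //.
by apply: contraNneq z0 => y0; rewrite -yz y0 expr0n.
Qed.

End Euler.

(** * The equation x^q + x = y^2 *)

Section TwistedTrace.

Variables (F L : finFieldType) (iota : {rmorphism F -> L}).
Local Notation q := #|F|.
Local Notation Fix := (frob_fix F L).

Hypothesis q_odd : odd q.

(** An analogue of the trace, adapted to x^q + x instead of x^q - x: its kernel on [twisted_fix n]
    will be the image of x |-> x^q + x. *)
Definition alt_trace n (z : L) : L := \sum_(l < n) (-1) ^+ l * z ^+ (q ^ l).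

(* For even n this is the field of q^n elements; for odd n it is the set of elements of
   the field of q^(2n) elements that conjugation over the field of q^n elements negates. *)
Definition twisted_fix n : {set L} := [set x | x ^+ (q ^ n) == (-1) ^+ n * x].

Lemma alt_traceB n : {morph alt_trace n : x y / x - y}.
Proof.
move=> x y; rewrite /alt_trace -sumrB; apply: eq_bigr => l _.
by rewrite (frobB iota) mulrBr.
Qed.

Lemma alt_trace0 n : alt_trace n 0 = 0.
Proof. by have := alt_traceB n 0 0; rewrite !subrr. Qed.

(** The alternating sum telescopes to x - (-1)^n x^(q^n). *)
Lemma alt_trace_image n x : x \in twisted_fix n -> alt_trace n (x ^+ q + x) = 0.
Proof.
rewrite inE => /eqP xn.
suff -> : alt_trace n (x ^+ q + x) = x - (-1) ^+ n * x ^+ (q ^ n).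
  by rewrite xn mulrA -exprD addnn -mul2n exprM sqrrN !expr1n mul1r subrr.
elim: n {xn} => [|n IH]; first by rewrite /alt_trace big_ord0 mul1r expr1 subrr.
rewrite /alt_trace big_ord_recr /= -/(alt_trace _ _) IH.
by rewrite (frobD iota) -exprM -expnS exprS; ring.
Qed.

Lemma signX_frob n l : ((-1) ^+ n) ^+ (q ^ l) = (-1) ^+ n :> L.
Proof.
by rewrite -exprM -signr_odd oddM oddX q_odd orbT andbT signr_odd.
Qed.

(** The terms l and l + i are combined. *)
Lemma alt_traceD2 i z :
  alt_trace (i + i) z = alt_trace i (z + (-1) ^+ i * z ^+ (q ^ i)).
Proof.
rewrite /alt_trace big_split_ord /= -big_split /=; apply: eq_bigr => l _.
rewrite (frobD iota) mulrDr; congr (_ + _).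
rewrite exprMn signX_frob -[(z ^+ _) ^+ _]exprM -expnD exprD mulrA.
by rewrite [(-1) ^+ i * _]mulrC.
Qed.

Lemma twisted_fix_even n : ~~ odd n -> twisted_fix n = Fix n.
Proof.
by move=> n_even; apply/setP => x; rewrite !inE -signr_odd (negPf n_even) mul1r.
Qed.

Definition alt_kernel := [set x : L | x ^+ q + x == 0].

(** Iterating x^q = -x gives x^(q^n) = (-1)^n x. *)
Lemma alt_kernel_sub n : alt_kernel \subset twisted_fix n.
Proof.
apply/fintype.subsetP => x; rewrite !inE addr_eq0 => /eqP xq.
elim: n => [|n /eqP IH]; first by rewrite mul1r expr1.
by rewrite expnSr exprM IH exprMn -{1}[q]expn1 signX_frob xq mulrN exprS mulN1r mulNr.
Qed.

Section Fibers.

Variable n : nat.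
Hypothesis n0 : (0 < n)%N.
Hypothesis card_ker : #|alt_kernel| = q.
Hypothesis card_tw : #|twisted_fix n| = (q ^ n)%N.

Lemma frob_twisted x : x \in twisted_fix n -> x ^+ q + x \in twisted_fix n.
Proof.
rewrite !inE => /eqP xn; rewrite (frobD iota) -exprM mulnC exprM xn exprMn.
by rewrite -{1}[q]expn1 signX_frob mulrDr.
Qed.

Lemma card_fiber_le z :
  (#|[set x in twisted_fix n | (x ^+ q + x == z)%R]| <= q)%N.
Proof.
have [->|[x0]] := set_0Vmem [set x in twisted_fix n | x ^+ q + x == z].
  by rewrite cards0.
rewrite inE => /andP[_ /eqP x0z].
apply: leq_trans (_ : #|[set (x + x0)%R | x in alt_kernel]| <= _)%N; last first.
  by rewrite (card_imset _ (addIr x0)) card_ker.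
apply/subset_leq_card/fintype.subsetP => x; rewrite inE => /andP[_ /eqP xz].
apply/imsetP; exists (x - x0); last by rewrite subrK.
rewrite inE -{1}[q]expn1 (frobB iota) expn1.
by rewrite addrACA -opprD xz x0z subrr.
Qed.

Lemma alt_trace_size :
  (#|[set z in twisted_fix n | (alt_trace n z == 0)%R]| <= q ^ n.-1)%N.
Proof.
pose p : {poly L} := \sum_(l < n) (-1) ^+ l *: 'X^(q ^ l).
have pE z : p.[z] = alt_trace n z.
  by rewrite horner_sum; apply: eq_bigr => l _; rewrite !hornerE.
have sp : size p = (q ^ n.-1).+1.
  rewrite /p -(prednK n0) big_ord_recr /= addrC size_polyDl.
    by rewrite size_scale ?signr_eq0 // size_polyXn.
  rewrite size_scale ?signr_eq0 // size_polyXn ltnS.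
  apply: leq_trans (size_sum _ _ _) _; apply/bigmax_leqP => l _.
  rewrite size_scale ?signr_eq0 // size_polyXn.
  by rewrite ltn_exp2l ?finNzRing_gt1.
have p0 : p != 0 by rewrite -size_poly_eq0 sp.
rewrite cardE -ltnS -sp; apply: max_poly_roots; rewrite ?enum_uniq //.
by apply/allP => z; rewrite mem_enum inE rootE pE => /andP[].
Qed.

(* Each fiber of x |-> x^q + x has at most q elements and its image lies in the kernel of
   alt_trace, which has at most q^(n-1) elements; as q^n elements are distributed, both
   bounds are attained. *)
Lemma card_fiber_ker :
  #|[set z in twisted_fix n | alt_trace n z == 0]| = (q ^ n.-1)%N /\
  forall z, z \in [set z in twisted_fix n | alt_trace n z == 0] ->
    #|[set x in twisted_fix n | x ^+ q + x == z]| = q.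
Proof.
set K := [set z in twisted_fix n | _].
pose fib (z : L) := #|[set x in twisted_fix n | x ^+ q + x == z]|.
have tot : (\sum_(z in K) fib z = q ^ n)%N.
  rewrite -card_tw -sum1_card [RHS](partition_big (fun x => x ^+ q + x) (mem K)) /=.
    by apply: eq_bigr => z _; rewrite sum1dep_card.
  by move=> x xn; rewrite inE frob_twisted // alt_trace_image // eqxx.
have lef z : z \in K -> (fib z <= q ?= iff (fib z == q))%N.
  by move=> _; split; first exact: card_fiber_le.
have := leqif_sum lef; rewrite tot sum_nat_const => -[le1 eq1].
have cK : #|K| = (q ^ n.-1)%N.
  apply/eqP; rewrite eqn_leq alt_trace_size /=.
  by rewrite -(leq_pmul2r (card_finField_gt0 F)) -expnSr prednK.
split=> // z zK; move: eq1; rewrite cK -expnSr prednK // eqxx => /esym/forall_inP.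
by move/(_ z zK)/eqP.
Qed.

Lemma card_fiber z : z \in twisted_fix n ->
  #|[set x in twisted_fix n | x ^+ q + x == z]| = ((alt_trace n z == 0)%R * q)%N.
Proof.
move=> zn; have [z0|z0] := eqVneq (alt_trace n z) 0.
  by rewrite mul1n card_fiber_ker.2 // inE zn z0 eqxx.
rewrite mul0n; apply/eqP; rewrite cards_eq0; apply/eqP/setP => x; rewrite !inE.
apply/negP => /andP[xn /eqP xz]; case/eqP: z0.
by rewrite -xz alt_trace_image // inE.
Qed.

End Fibers.

End TwistedTrace.

(** Upper bounds whose sum equals the actual total must all be attained; here one index has a bound
    of its own. *)
Lemma extremal_fibers (T : finType) (V : {set T}) (t0 : T) (f : T -> nat) (s f0 Q : nat) :
  t0 \in V -> (\sum_(t in V) f t = Q)%N -> (f t0 <= f0)%N ->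
  (forall t, t \in V -> t != t0 -> (f t <= s)%N) ->
  (f0 + #|V|.-1 * s = Q)%N ->
  f t0 = f0 /\ forall t, t \in V -> t != t0 -> f t = s.
Proof.
move=> Vt0 fQ ft0 fs Qe.
have cV : #|V|.-1 = #|[set t in V | t != t0]|.
  rewrite (cardsD1 t0 V) Vt0 add1n /=; apply: eq_card => t.
  by rewrite !inE andbC.
have lef t : (t \in V) && (t != t0) -> (f t <= s ?= iff (f t == s))%N.
  by case/andP=> tV tt0; split; first exact: fs.
have := leqif_sum lef; rewrite sum_nat_const.
have -> : #|(fun t => (t \in V) && (t != t0))| = #|V|.-1.
  by rewrite cV; apply: eq_card => t; rewrite [RHS]inE.
move: fQ; rewrite (bigD1 t0) //=; move: (\sum_(_ in _ | _) _)%N => S fQ [le1 eq1].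
have ft0E : f t0 = f0 by lia.
split=> // t tV tt0; move: eq1; have -> : (S == #|V|.-1 * s)%N by apply/eqP; lia.
by move/esym/forall_inP/(_ t); rewrite tV tt0 => /(_ isT)/eqP.
Qed.

(** * Fibers of a quadratic form on the field of q^(2i) elements *)

Section TraceForm.

Variables (F L : finFieldType) (iota : {rmorphism F -> L}).
Local Notation q := #|F|.
Local Notation Fix := (frob_fix F L).

Hypothesis q_odd : odd q.

Variable i : nat.
Hypothesis i0 : (0 < i)%N.
Hypothesis card_tw : #|twisted_fix F L i| = (q ^ i)%N.
Hypothesis card_F2i : #|Fix (i + i)| = (q ^ (i + i))%N.
Hypothesis card_Fi : #|Fix i| = (q ^ i)%N.
Hypothesis card_ker : #|alt_kernel F L| = q.
Variable im : F.
Hypothesis imE : im ^+ 2 = -1.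

(* By alt_traceD2, alt_trace (i + i) (y ^+ 2) = alt_trace i (frob_form y). *)
Definition frob_form (y : L) : L := y ^+ 2 + (-1) ^+ i * (y ^+ 2) ^+ (q ^ i).

Lemma frob_form_twisted y : y \in Fix (i + i) -> frob_form y \in twisted_fix F L i.
Proof.
rewrite !inE /frob_form => /eqP yK; rewrite (frobD iota) !exprMn signX_frob //.
rewrite -!exprM -!expnD yK; set Y := y ^+ _; set e := (-1) ^+ i.
have ee : e * e = 1 :> L by rewrite -expr2 sqrr_sign.
by apply/eqP; rewrite mulrDr [e * (e * _)]mulrA ee; ring.
Qed.

Lemma conjK y : y \in Fix (i + i) -> (y ^+ (q ^ i)) ^+ (q ^ i) = y.
Proof. by move/FixP; rewrite -exprM -expnD. Qed.

Lemma addrr_inj (x y : L) : x + x = y + y -> x = y.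
Proof.
move=> xy; apply/eqP; rewrite -subr_eq0; apply/negPn/negP => d0.
case/eqP: (oppr_neq iota q_odd d0); apply/eqP; rewrite -subr_eq0.
have -> : - (x - y) - (x - y) = (y + y) - (x + x) by ring.
by rewrite xy subrr.
Qed.

Definition form_fiber t : nat := #|[set y in Fix (i + i) | (frob_form y == t)%R]|.

Lemma sum_form_fiber : (\sum_(t in twisted_fix F L i) form_fiber t = q ^ (i + i))%N.
Proof.
rewrite -card_F2i -sum1_card [RHS](partition_big frob_form (mem (twisted_fix F L i))) /=.
  by apply: eq_bigr => z _; rewrite sum1dep_card.
by move=> x xn; apply: frob_form_twisted.
Qed.

Lemma odd_form (y : L) : odd i -> 
  frob_form y = (y + y ^+ (q ^ i)) * (y - y ^+ (q ^ i)).
Proof.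
move=> io; rewrite /frob_form -signr_odd io expr1 -exprM mulnC exprM; ring.
Qed.

(** The zeros form the two eigenspaces of y |-> y^(q^i), for 1 and -1; each has q^i elements, and
    both contain 0. *)
Lemma odd_fiber0 : odd i -> (form_fiber 0%R <= (q ^ i).*2.-1)%N.
Proof.
move=> io; apply: leq_trans (_ : #|Fix i :|: twisted_fix F L i| <= _)%N.
  apply/subset_leq_card/fintype.subsetP => y; rewrite !inE odd_form // mulf_eq0.
  rewrite -(signr_odd _ i) io mulN1r addr_eq0 subr_eq0 => /andP[_].
  by rewrite eq_sym eqr_oppLR orbC [y == _]eq_sym.
rewrite cardsU card_Fi card_tw addnn -subn1 leq_sub2l // card_gt0.
apply/set0Pn; exists 0; rewrite !inE expr0n gtn_eqF ?frob_gt0 //.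
by rewrite mulr0 eqxx.
Qed.

(** The factor [a y] is a nonzero element of the field of q^i elements. It determines the other
    factor t / a, and the two factors add up to 2y. *)
Lemma odd_fiber t : odd i -> t != 0 -> (form_fiber t <= (q ^ i).-1)%N.
Proof.
move=> io t0; rewrite -card_Fi (cardsD1 0) Fix0 /= /form_fiber.
pose a (y : L) := y + y ^+ (q ^ i).
rewrite -(@card_in_imset _ _ a) => [|x y].
  apply/subset_leq_card/fintype.subsetP => _ /imsetP[y + ->].
  rewrite !inE odd_form // => /andP[yK /eqP yt]; apply/andP; split.
    by apply: contraNneq t0 => a0; rewrite -yt -/(a y) a0 mul0r.
  by rewrite (frobD iota) conjK ?inE // addrC.
rewrite !inE !odd_form // => /andP[_ /eqP xt] /andP[_ /eqP yt] axy.
have a0 : a x != 0 by apply: contraNneq t0 => a0; rewrite -xt -/(a x) a0 mul0r.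
have bxy : x - x ^+ (q ^ i) = y - y ^+ (q ^ i).
  by apply: (mulfI a0); rewrite xt -yt -/(a y) axy.
apply: addrr_inj; have := congr2 +%R axy bxy; rewrite /a.
by rewrite [LHS]addrACA [RHS]addrACA !subrr !addr0.
Qed.

(** Up to the factor [im], the form is the norm of y + im y^(q^i) to the field of q^i elements: the
    cross terms cancel because im^2 = -1. *)
Lemma even_norm (y : L) : ~~ odd i -> y \in Fix (i + i) ->
  (y + iota im * y ^+ (q ^ i)) ^+ (q ^ i).+1 = iota im * frob_form y.
Proof.
move=> ie yK; rewrite exprS (frobD iota) exprMn frob_iota conjK //.
rewrite /frob_form -signr_odd (negPf ie) -exprM mulnC exprM.
have e : iota im * iota im = -1 by rewrite -rmorphM -expr2 imE rmorphN1.
transitivity (y * y ^+ (q ^ i) + (iota im * iota im) * (y * y ^+ (q ^ i)) +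
  iota im * (y ^+ 2 + y ^+ (q ^ i) ^+ 2)); first by ring.
by rewrite e; ring.
Qed.

(** The element y is recovered from a = y + im y^(q^i) by 2y = a - im a^(q^i). *)
Lemma even_inj : ~~ odd i ->
  {in Fix (i + i) &, injective (fun y : L => y + iota im * y ^+ (q ^ i))}.
Proof.
move=> ie x y xK yK xy; apply: addrr_inj.
have e : iota im * iota im = -1 by rewrite -rmorphM -expr2 imE rmorphN1.
have dbl z : z \in Fix (i + i) -> z + z = z + iota im * z ^+ (q ^ i)
    - iota im * (z + iota im * z ^+ (q ^ i)) ^+ (q ^ i).
  move=> zK; rewrite (frobD iota) exprMn frob_iota conjK // mulrDr mulrA e.
  by ring.
by rewrite (dbl x xK) (dbl y yK) /= xy.
Qed.

Lemma even_fiber0 : ~~ odd i -> (form_fiber 0%R <= 1)%N.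
Proof.
move=> ie; rewrite -(cards1 (0 : L)); apply/subset_leq_card/fintype.subsetP => y.
case/setIdP=> yK /eqP y0; have := even_norm ie yK.
rewrite y0 mulr0 => /eqP; rewrite expf_eq0 /= => /eqP z0.
rewrite finset.in_set1; apply/eqP; apply: (even_inj ie yK (Fix0 F L _)) => /=.
by rewrite z0 expr0n gtn_eqF ?frob_gt0 // mulr0 addr0.
Qed.

(** By [even_norm] the fiber embeds into the roots of a polynomial of degree q^i + 1. *)
Lemma even_fiber t : ~~ odd i -> (form_fiber t <= (q ^ i).+1)%N.
Proof.
move=> ie; pose a (y : L) := y + iota im * y ^+ (q ^ i).
rewrite /form_fiber -(@card_in_imset _ _ a) => [|x y]; last first.
  by case/setIdP=> xK _ /setIdP[yK _]; apply: even_inj.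
have sp : size ('X^((q ^ i).+1) - (iota im * t)%:P : {poly L}) = (q ^ i).+2.
  by rewrite size_XnsubC.
rewrite -ltnS -sp cardE; apply: max_poly_roots; rewrite ?enum_uniq //.
  by rewrite -size_poly_eq0 sp.
apply/allP => z; rewrite mem_enum => /imsetP[y + ->].
case/setIdP=> yK /eqP <-.
by rewrite rootE !hornerE even_norm ?subrr.
Qed.

Definition fiber_size := if odd i then (q ^ i).-1 else (q ^ i).+1.
Definition fiber_size0 := if odd i then (q ^ i).*2.-1 else 1%N.

(* The upper bounds found for the fibers of frob_form add up to the number of elements,
   so they are attained. *)
Lemma form_fiberE :
  form_fiber 0 = fiber_size0 /\
  forall t, t \in twisted_fix F L i -> t != 0 -> form_fiber t = fiber_size.
Proof.
apply: extremal_fibers sum_form_fiber _ _ _.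
- by rewrite inE expr0n gtn_eqF ?frob_gt0 // mulr0.
- rewrite /fiber_size0; case: ifPn; [exact: odd_fiber0 | exact: even_fiber0].
- move=> t _ t0; rewrite /fiber_size; case: ifPn => io; last exact: even_fiber.
  exact: odd_fiber.
(* With Q = q^i the bounds add up to (2Q - 1) + (Q - 1)^2 = Q^2 for odd i and to 1 + (Q - 1)(Q + 1)
   = Q^2 for even i. *)
rewrite card_tw /fiber_size /fiber_size0 expnD; have := frob_gt0 F i.
by move: (q ^ i)%N => Q Q0; case: (odd i); nia.
Qed.

(** The condition says that [frob_form y] lies in the kernel of [alt_trace] on [twisted_fix]. This
    kernel has q^(i-1) elements, among them 0, and the fiber sizes are summed over it. *)
Lemma card_trace_form :
  #|[set y in Fix (i + i) | alt_trace F (i + i) (y ^+ 2) == 0]| =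
    (fiber_size0 + (q ^ i.-1).-1 * fiber_size)%N.
Proof.
have [f0 fs] := form_fiberE.
pose K := [set t in twisted_fix F L i | alt_trace F i t == 0].
have K0 : 0 \in K by rewrite !inE expr0n gtn_eqF ?frob_gt0 // mulr0 alt_trace0 // !eqxx.
have [cK _] := card_fiber_ker iota q_odd i0 card_ker card_tw.
rewrite -sum1_card (partition_big frob_form (mem K)) /=; last first.
  move=> y; rewrite inE (alt_traceD2 iota) // => /andP[yK y0].
  by rewrite inE frob_form_twisted.
rewrite (eq_bigr form_fiber) => [|t]; last first.
  rewrite inE => /andP[ti t0]; rewrite sum1dep_card; apply: eq_card => y.
  rewrite !inE (alt_traceD2 iota) // -/(frob_form y).
  by have [->|] := eqVneq (frob_form y) t; rewrite ?t0 ?andbT ?andbF.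
rewrite (bigD1 0) //= f0; congr addn.
rewrite (eq_bigr (fun=> fiber_size)) => [|t /andP[]]; last first.
  by rewrite inE => /andP[ti _]; apply: fs.
rewrite sum_nat_const -cK (cardsD1 0 K) K0 add1n /=; congr muln.
by apply: eq_card => t; rewrite in_setD1 andbC.
Qed.

End TraceForm.

(** * Character sums *)

Section CharacterSum.

Variables (F L : finFieldType) (iota : {rmorphism F -> L}).
Local Notation q := #|F|.
Local Notation Fix := (frob_fix F L).

Hypothesis q_odd : odd q.

Lemma half_orderM d k :
  half_order F (d * k) = (half_order F d * \sum_(i < k) (q ^ d) ^ i)%N.
Proof.
apply: double_inj; rewrite half_orderE // expnM predn_exp -half_orderE //.
by rewrite -doubleMl.
Qed.

Lemma odd_sum_expn d k : odd (\sum_(i < k) (q ^ d) ^ i)%N = odd k.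
Proof.
elim: k => [|k IH]; first by rewrite big_ord0.
by rewrite big_ord_recr /= oddD IH !oddX q_odd !orbT addbT.
Qed.

(** The exponents in the two Euler criteria differ by a factor that is a sum of k odd numbers, so it
    has the parity of k. *)
Lemma quad_charX d k (z : L) : (0 < d)%N -> (0 < k)%N -> z \in Fix d ->
  quad_char F (d * k) z = quad_char F d z ^+ k.
Proof.
move=> d0 k0 zd; have := odd_sum_expn d k; rewrite /quad_char half_orderM exprM.
have [_ _|z0] := eqVneq z 0; first by rewrite expr0n gtn_eqF.
have := Fix_expr1 zd z0; rewrite -half_orderE // -muln2 exprM => /eqP.
rewrite sqrf_eq1 => /orP[]/eqP-> odk; rewrite ?expr1n ?eqxx ?expr1n //.
rewrite -signr_odd odk signr_odd [-1 == 1]eq_sym (negPf (oner_neqN1 iota q_odd)).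
by rewrite -signr_odd -[RHS]signr_odd; case: (odd k); rewrite ?eqxx // expr1
  eq_sym (negPf (oner_neqN1 iota q_odd)).
Qed.

Lemma quad_charM j (x y : L) : (0 < j)%N -> x \in Fix j -> y \in Fix j ->
  quad_char F j (x * y) = quad_char F j x * quad_char F j y.
Proof.
move=> j0 xj yj; apply: (sign_intr_inj iota q_odd); first exact: quad_char_sign.
  have := quad_char_sign F j x; have := quad_char_sign F j y.
  by rewrite !inE => /or3P[]/eqP-> /or3P[]/eqP->.
by rewrite intrM !(quad_charE q_odd) ?FixM // exprMn.
Qed.

Lemma nonresidue : exists2 a : F, a != 0 & quad_char F 1 (iota a) = -1.
Proof.
have h0 : (0 < half_order F 1)%N by apply: half_order_gt0.
have [/existsP[a /andP[a0 na]]|] :=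
    boolP [exists a : F, (a != 0) && (a ^+ half_order F 1 != 1)].
  exists a => //; rewrite /quad_char fmorph_eq0 (negPf a0) -rmorphXn.
  by rewrite fmorph_eq1 (negPf na).
rewrite negb_exists => /forallP H; have := card_expr1 F h0.
have sub : [set~ (0 : F)] \subset [set z : F | z ^+ half_order F 1 == 1].
  apply/fintype.subsetP => a; rewrite in_setC1 inE => a0.
  by have := H a; rewrite a0 negbK.
move/(leq_trans (subset_leq_card sub)); rewrite cardsC1.
by have := half_orderE q_odd 1; rewrite expn1 => <-; rewrite -addnn; lia.
Qed.

Definition char_sum j : int := \sum_(x in Fix j) quad_char F j (x ^+ q + x).

Lemma Fix_iota a j : iota a \in Fix j.
Proof. by rewrite inE frob_iota. Qed.

Lemma FixX j x n : x \in Fix j -> x ^+ n \in Fix j.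
Proof. by move/FixP => xj; rewrite inE exprAC xj. Qed.

(** Scaling x by a nonresidue a of [F] multiplies x^q + x by a, which stays a nonresidue in odd
    degree; hence the sum equals its own negative. *)
Lemma char_sum_odd j : odd j -> char_sum j = 0.
Proof.
move=> jo; have j0 : (0 < j)%N by case: (j) jo.
have [a a0 na] := nonresidue.
have aj : quad_char F j (iota a) = -1.
  have := quad_charX (isT : 0 < 1)%N j0 (Fix_iota a 1).
  by rewrite mul1n na -signr_odd jo.
have fa : iota a ^+ q = iota a by have := frob_iota iota a 1; rewrite expn1.
have ia0 : iota a != 0 by rewrite fmorph_eq0.
have e : char_sum j = - char_sum j.
  rewrite {1}/char_sum (reindex_onto (fun x => iota a * x) (fun x => (iota a)^-1 * x)) /=.
    rewrite /char_sum -sumrN; apply: eq_big => [x|x /andP[xj _]].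
      rewrite mulKf // eqxx andbT; apply/idP/idP => [|xj].
        move/(FixM (Fix_iota a^-1 j)); rewrite fmorphV mulKf //.
      by rewrite FixM // Fix_iota.
    rewrite exprMn fa -mulrDr quad_charM ?Fix_iota // ?aj ?mulN1r //.
    have {}xj : x \in Fix j.
      by move/(FixM (Fix_iota a^-1 j)): xj; rewrite fmorphV mulKf.
    by rewrite (FixD iota) ?FixX.
  by move=> x _; rewrite mulVKf.
by move: e; lia.
Qed.

(** The exponent (q^(2i) - 1)/2 is a multiple of q^i - 1. *)
Lemma quad_char_subfield i z : z \in Fix i -> z != 0 -> quad_char F (i + i) z = 1.
Proof.
move=> zi z0; rewrite /quad_char (negPf z0); case: eqP => // -[].
have -> : half_order F (i + i) = ((q ^ i).-1 * (half_order F i).+1)%N.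
  apply: double_inj; rewrite half_orderE // doubleMr doubleS half_orderE //.
  by have := frob_gt0 F i; rewrite expnD; move: (q ^ i)%N => Q Q0; nia.
by rewrite exprM Fix_expr1 // expr1n.
Qed.

(** The number of roots of T^q + T in the field of q^i elements: a root satisfies x^(q^i) = (-1)^i
    x, so for odd i only 0 qualifies. *)
Definition fixed_roots i := if odd i then 1%N else q.

Lemma char_sum_subfield i : #|Fix i| = (q ^ i)%N -> #|alt_kernel F L| = q ->
  \sum_(x in Fix i) quad_char F (i + i) (x ^+ q + x) = (q ^ i)%N%:Z - (fixed_roots i)%:Z.
Proof.
move=> card_Fi card_ker.
have ker : #|[set x in Fix i | x ^+ q + x == 0]| = fixed_roots i.
  rewrite /fixed_roots; case: ifPn => io.
    rewrite -(cards1 (0 : L)); apply: eq_card => x; rewrite !inE.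
    apply/idP/idP => [/andP[/eqP xi]|/eqP->]; last first.
      by rewrite !expr0n !gtn_eqF ?frob_gt0 ?card_finField_gt0 // addr0 eqxx.
    move=> xk; have := fintype.subsetP (alt_kernel_sub L q_odd i) x; rewrite !inE => /(_ xk).
    rewrite xi -signr_odd io mulN1r; apply: contraTT => x0.
    by rewrite eq_sym (oppr_neq iota q_odd).
  rewrite -[RHS]card_ker; apply: eq_card => x; rewrite -(twisted_fix_even F L io) // !inE.
  by apply: andb_idl => xk; have := fintype.subsetP (alt_kernel_sub L q_odd i) x; rewrite !inE; apply.
have -> : (q ^ i)%N%:Z = \sum_(x in Fix i) 1.
  by rewrite sumr_const card_Fi natz.
have -> : (fixed_roots i)%:Z = \sum_(x in Fix i) (x ^+ q + x == 0)%:R.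
  rewrite -ker -sum1dep_card -natz natr_sum big_mkcondr /=.
  by apply: eq_bigr => x _; case: eqP.
rewrite -sumrB; apply: eq_bigr => x xi.
case: eqP => [->|/eqP x0]; first by rewrite /quad_char eqxx subrr.
by rewrite subr0 quad_char_subfield // (FixD iota) ?FixX.
Qed.

Hypothesis q4 : (q %% 4 = 1)%N.

Lemma sqrtN1 : exists x : F, x ^+ 2 = -1.
Proof.
have h0 : (0 < half_order F 1)%N by apply: half_order_gt0.
have c1 : #|frob_fix F F 1| = (q ^ 1)%N.
  rewrite expn1 -[RHS]cardsT; apply: eq_card => x.
  by rewrite !inE expn1 expf_card eqxx.
have N1 : (-1 : F) \in frob_fix F F 1 by rewrite inE expn1 expf_card.
have [|x _ xE] := Fix_squareP q_odd (isT : (0 < 1)%N) c1 N1; last by exists x.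
have := half_orderE q_odd 1; rewrite expn1 => hE.
rewrite -signr_odd; case: (boolP (odd _)) => // ho.
by have := q4; move: hE ho; move: (half_order F 1) => h; lia.
Qed.

Section EvenDegree.

Variable i : nat.
Hypothesis i0 : (0 < i)%N.
Hypothesis card_tw : #|twisted_fix F L i| = (q ^ i)%N.
Hypothesis card_F2i : #|Fix (i + i)| = (q ^ (i + i))%N.
Hypothesis card_Fi : #|Fix i| = (q ^ i)%N.
Hypothesis card_ker : #|alt_kernel F L| = q.

(** By [card_sqrt] the sum is the number of solutions of y^2 = x^q + x minus q^(2i). Counted by y,
    the solutions come in fibers of q elements over those y for which [alt_trace] kills y^2. *)
Lemma char_sum_even : char_sum (i + i) = - (q%:Z - 1) * (- q%:Z) ^+ i.
Proof.
have ii0 : (0 < i + i)%N by rewrite addn_gt0 i0.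
have tw2 : twisted_fix F L (i + i) = Fix (i + i).
  by rewrite twisted_fix_even // addnn odd_double.
have mK x : x \in Fix (i + i) -> x ^+ q + x \in Fix (i + i).
  by move=> xK; rewrite (FixD iota) ?FixX.
have -> : char_sum (i + i) =
    (\sum_(x in Fix (i + i)) #|[set y in Fix (i + i) | (y ^+ 2 == x ^+ q + x)%R]|)%N%:Z
    - (q ^ (i + i))%N%:Z.
  rewrite -card_F2i -sum1_card -!natz !natr_sum -sumrB; apply: eq_bigr => x xK.
  rewrite !natz (card_sqrt iota q_odd) ?mK // addrAC subrr add0r //.
have -> : (\sum_(x in Fix (i + i)) #|[set y in Fix (i + i) | (y ^+ 2 == x ^+ q + x)%R]| =
    (fiber_size0 F i + (q ^ i.-1).-1 * fiber_size F i) * q)%N.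
  have [im imE] := sqrtN1; rewrite -(card_trace_form iota q_odd i0 _ _ _ _ imE) //.
  under eq_bigr do rewrite -sum1dep_card big_mkcondr /=.
  rewrite exchange_big -[in RHS]sum1dep_card big_mkcondr big_distrl /=.
  apply: eq_bigr => y yK; rewrite -big_mkcondr sum1dep_card -tw2.
  under eq_finset do rewrite eq_sym.
  rewrite (card_fiber iota) ?tw2 ?FixX //; case: eqP => //.
have P0 := frob_gt0 F i.-1; have Q0 := frob_gt0 F i.
have QP : (q ^ i = q * q ^ i.-1)%N by rewrite -expnS prednK.
have Nq : (- q%:Z) ^+ i = (-1) ^+ odd i * (q ^ i)%N%:Z.
  by rewrite signr_odd [LHS]exprNn -[Posz (q ^ i)]natz natrX natz.
rewrite Nq expnD /fiber_size /fiber_size0.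
move: (q ^ i)%N (q ^ i.-1)%N P0 Q0 QP => Q P P0 Q0 QP.
rewrite !(PoszM, PoszD); case: (odd i).
  have -> : Q.*2.-1%:Z = 2 * Q%:Z - 1 by lia.
  have -> : Q.-1%:Z = Q%:Z - 1 by lia.
  have -> : P.-1%:Z = P%:Z - 1 by lia.
  have e : Q%:Z = q%:Z * P%:Z by rewrite QP PoszM.
  by rewrite expr1; ring: e.
have -> : P.-1%:Z = P%:Z - 1 by lia.
have -> : Q.+1%:Z = Q%:Z + 1 by lia.
have e : Q%:Z = q%:Z * P%:Z by rewrite QP PoszM.
by rewrite expr0; ring: e.
Qed.

End EvenDegree.
End CharacterSum.

(** * The Liouville function and the Jacobi symbol *)

Lemma multp_geq (F : fieldType) (P f : {poly F}) k : f != 0 -> (1 < size P)%N ->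
  (k <= multp P f)%N = (P ^+ k %| f).
Proof.
move=> f0 sP; have P0 : P != 0 by rewrite -size_poly_gt0 ltnW.
apply/idP/idP => [|Pf].
  have [|n Pn e] := @eq_bigmax_cond _ [pred n : 'I_(size f).+1 | P ^+ n %| f] val.
    by apply/card_gt0P; exists ord0; rewrite inE dvd1p.
  by rewrite /multp e => /(dvdp_exp2l P)/dvdp_trans; apply.
have kf : (k < (size f).+1)%N.
  have := dvdp_leq f0 Pf; have := size_exp P k.
  have : (0 < size (P ^+ k))%N by rewrite size_poly_gt0 expf_neq0.
  move: (size P) (size (P ^+ k)) (size f) sP => a b c; nia.
exact: (@leq_bigmax_cond _ _ val (Ordinal kf)).
Qed.

Lemma irreducible_dvdM (F : fieldType) (P f g : {poly F}) : irreducible_poly P ->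
  (P %| f * g) = (P %| f) || (P %| g).
Proof.
move=> irrP; have [Pf|nPf] := boolP (P %| f); first by rewrite dvdp_mulr.
by rewrite Gauss_dvdpr // irreducible_poly_coprime.
Qed.

(** Once the exact powers of P are split off, P divides neither cofactor, hence not their
    product. *)
Lemma multpM (F : fieldType) (P f g : {poly F}) : irreducible_poly P ->
  f != 0 -> g != 0 -> multp P (f * g) = (multp P f + multp P g)%N.
Proof.
move=> irrP f0 g0; have sP := irrP.1.
have P0 : P != 0 by rewrite -size_poly_gt0 ltnW.
have fg0 : f * g != 0 by rewrite mulf_neq0.
have split h : h != 0 -> exists2 h', h = h' * P ^+ multp P h & ~~ (P %| h').
  move=> h0; have := leqnn (multp P h); rewrite multp_geq // => /dvdpP[h' hE].
  exists h' => //; apply/negP => Ph'; have := ltnn (multp P h).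
  by rewrite multp_geq // exprS [X in _ %| X]hE dvdp_mul.
have [f' fE nf] := split f f0; have [g' gE ng] := split g g0.
apply/eqP; rewrite eqn_leq [X in _ && X]multp_geq // exprD dvdp_mul -?multp_geq //.
rewrite andbT leqNgt multp_geq // [in X in _ %| X]fE [in X in _ %| X]gE.
rewrite mulrACA -exprD exprS dvdp_mul2r ?expf_neq0 // irreducible_dvdM //.
by rewrite negb_or nf.
Qed.

Lemma monic_irredP (F : finFieldType) (P : {poly F}) :
  reflect (P \is monic /\ irreducible_poly P) (monic_irred P).
Proof. by apply: (iffP andP) => -[mP /irreducibleP iP]. Qed.

Lemma multp_monic_irred (F : finFieldType) (P Q : {poly F}) :
  monic_irred P -> monic_irred Q -> multp P Q = (P == Q).
Proof.
move=> /monic_irredP[mP iP] /monic_irredP[mQ iQ].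
have sP := iP.1; have Q0 := monic_neq0 mQ.
have [<-|PQ] := eqVneq P Q.
  have P0 := monic_neq0 mP.
  apply/eqP; rewrite eqn_leq multp_geq // expr1 dvdpp andbT.
  rewrite leqNgt multp_geq //; apply/negP => /(dvdp_leq P0).
  by rewrite expr2 size_mul //; move: (size P) sP => d; lia.
apply/eqP; rewrite -leqn0 leqNgt multp_geq // expr1; apply: contra PQ => PdQ.
have sP1 : size P != 1%N by rewrite neq_ltn sP orbT.
by rewrite -eqp_monic // iQ.2.
Qed.

(** The index type of [big_omega f] depends on f; widening it lets f, g and f g share one index
    type. *)
Lemma big_npoly_widen (F : finFieldType) (A : Type) (idx : A) (op : Monoid.com_law idx)
    (s B : nat) (C : pred {poly F}) (G : {poly F} -> A) : (s <= B)%N ->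
  (forall P, C P -> (s < size P)%N -> G P = idx) ->
  \big[op/idx]_(P : {poly_B F} | C (polyn P)) G (polyn P) =
  \big[op/idx]_(P : {poly_s F} | C (polyn P)) G (polyn P).
Proof.
move=> sB G1; rewrite (bigID (fun P : {poly_B F} => size (polyn P) <= s)%N) /=.
rewrite [X in op _ X]big1 ?Monoid.mulm1; last first.
  by move=> P /andP[CP]; rewrite -ltnNge; apply: G1.
rewrite (reindex_onto (fun P : {poly_s F} => npolyp B (polyn P))
  (fun P : {poly_B F} => npolyp s (polyn P))) /=; last first.
  by move=> P /andP[_ sP]; apply: val_inj; rewrite /= !npolypK.
have up (P : {poly_s F}) : polyn (npolyp B (polyn P)) = polyn P.
  by rewrite npolypK // (leq_trans (size_npoly P)).
apply: eq_big => P; rewrite up // size_npoly andbT.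
suff -> : npolyp s (polyn P) == P by rewrite andbT.
by apply/eqP/val_inj; rewrite /= npolypK ?size_npoly.
Qed.

Lemma big_omega_widen (F : finFieldType) (f : {poly F}) B :
  f != 0 -> (size f <= B)%N ->
  big_omega f = (\sum_(P : {poly_B F} | monic_irred (polyn P)) multp (polyn P) f)%N.
Proof.
move=> f0 sB; rewrite (@big_npoly_widen _ _ _ addn (size f) B
  (fun P => monic_irred P) (fun P => multp P f)) //.
move=> P /monic_irredP[_ [sP _]] fP; apply/eqP; rewrite -leqn0 leqNgt multp_geq //.
by apply/negP; rewrite expr1 => /(dvdp_leq f0); rewrite leqNgt fP.
Qed.

Lemma big_omegaM (F : finFieldType) (f g : {poly F}) : f != 0 -> g != 0 ->
  big_omega (f * g) = (big_omega f + big_omega g)%N.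
Proof.
move=> f0 g0; have fg0 : f * g != 0 by rewrite mulf_neq0.
have sE : size (f * g) = (size f + size g).-1 by rewrite size_mul.
have sf := f0; have sg := g0; rewrite -size_poly_gt0 in sf; rewrite -size_poly_gt0 in sg.
rewrite /(big_omega (f * g)) (big_omega_widen f0 (B := size (f * g))); last first.
  by rewrite sE; move: (size f) (size g) sf sg => a b; lia.
rewrite (big_omega_widen g0 (B := size (f * g))); last first.
  by rewrite sE; move: (size f) (size g) sf sg => a b; lia.
rewrite -big_split /=; apply: eq_bigr => P /monic_irredP[_ iP].
exact: multpM.
Qed.

Lemma liouvilleM (F : finFieldType) (f g : {poly F}) : f != 0 -> g != 0 ->
  liouville (f * g) = liouville f * liouville g.
Proof. by move=> f0 g0; rewrite /liouville big_omegaM // exprD. Qed.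

Lemma liouville_irred (F : finFieldType) (P : {poly F}) :
  monic_irred P -> liouville P = -1.
Proof.
move=> iP; rewrite /liouville; suff -> : big_omega P = 1%N by rewrite expr1.
rewrite /big_omega (bigD1 (NPoly (leqnn (size P)))) //= multp_monic_irred // eqxx.
rewrite big1 // => Q /andP[iQ QP]; rewrite multp_monic_irred //.
by case: eqP => // QE; case/eqP: QP; apply: val_inj.
Qed.

(** * Residue symbols as powers of products over roots *)

Section Residue.

Variables (F L : finFieldType) (iota : {rmorphism F -> L}).
Local Notation q := #|F|.
Local Notation Fix := (frob_fix F L).
Local Notation "f ^i" := (map_poly iota f) (at level 2, format "f ^i").
Local Notation frob := (frobenius iota).
Local Notation ord := (fingraph.order frob).
Local Notation orb := (fingraph.orbit frob).

Hypothesis q_odd : odd q.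

Lemma Fix_ord x : x \in Fix (ord x).
Proof. by rewrite -(order_frob_dvd iota). Qed.

Lemma horner_Fix (f : {poly F}) j x : x \in Fix j -> f^i.[x] \in Fix j.
Proof. by move/FixP => xj; rewrite inE -frob_horner xj. Qed.

(** Evaluation at x is injective below the degree of the minimal polynomial, and its source and
    target have the same number of elements. *)
Lemma horner_Fix_onto x y : #|Fix (ord x)| = (q ^ ord x)%N -> y \in Fix (ord x) ->
  exists2 g : {poly F}, (size g <= ord x)%N & g^i.[x] = y.
Proof.
move=> cx yx; pose ev (g : {poly_(ord x) F}) := (polyn g)^i.[x].
have ev_inj : injective ev.
  move=> g h; rewrite /ev => gh; apply/val_inj/eqP; rewrite /= -subr_eq0.
  have : root (polyn g - polyn h)^i x.
    by rewrite rmorphB /= rootE !hornerE gh subrr.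
  rewrite min_poly_dvdP; apply: contraTT => gh0; apply/negP => /(dvdp_leq gh0).
  rewrite size_min_poly ltnNge; apply/negP; rewrite negbK.
  by rewrite (leq_trans (size_polyD _ _)) // geq_max size_polyN !size_npoly.
have sub : [set ev g | g in [set: {poly_(ord x) F}]] \subset Fix (ord x).
  by apply/fintype.subsetP => _ /imsetP[g _ ->]; apply: horner_Fix (Fix_ord x).
have /eqP E : [set ev g | g in [set: {poly_(ord x) F}]] == Fix (ord x).
  by rewrite eqEcard sub card_imset // cardsT card_npoly cx leqnn.
move: yx; rewrite -E => /imsetP[g _ ->]; exists (polyn g) => //.
Qed.

(** Evaluation at x identifies the residue field with [Fix (ord x)], where Euler's criterion detects
    squares. *)
Lemma legendreE (f : {poly F}) x : #|Fix (ord x)| = (q ^ ord x)%N ->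
  legendre f (min_poly iota x) = quad_char F (ord x) f^i.[x].
Proof.
move=> cx; rewrite /legendre -min_poly_dvdP /quad_char.
have -> : root f^i x = (f^i.[x] == 0) by [].
case: eqP => // /eqP z0; set z := f^i.[x].
have zx : z \in Fix (ord x) by apply: horner_Fix (Fix_ord x).
have d0 : (0 < ord x)%N by rewrite fingraph.order_gt0.
case: ifPn => [/existsP[g]|].
  rewrite -min_poly_dvdP rmorphB rmorphXn /= rootE hornerD hornerN horner_exp subr_eq0 => /eqP zE.
  have y0 : (polyn g)^i.[x] != 0 by apply: contraNneq z0 => y0; rewrite zE y0 expr0n.
  rewrite /z zE -exprM mul2n half_orderE // Fix_expr1 ?eqxx //.
  exact: horner_Fix (Fix_ord x).
rewrite negb_exists => /forallP nog; case: eqP => // z1.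
have [y yx yz] := Fix_squareP q_odd d0 cx zx z1.
have [g sg gy] := horner_Fix_onto cx yx.
have sg' : (size g <= size (min_poly iota x))%N.
  by rewrite size_min_poly (leq_trans sg).
case/negP: (nog (NPoly sg')) => /=.
by rewrite -min_poly_dvdP rmorphB rmorphXn /= rootE hornerD hornerN horner_exp gy yz subrr.
Qed.

Lemma min_poly_uniq (P : {poly F}) x : monic_irred P -> root P^i x -> P = min_poly iota x.
Proof.
case/monic_irredP=> mP [_ iP]; rewrite min_poly_dvdP => xP.
apply/esym/eqP; rewrite -eqp_monic ?min_poly_monic // iP //.
by rewrite size_min_poly eqSS -lt0n fingraph.order_gt0.
Qed.

Lemma min_poly_monic_irred x : monic_irred (min_poly iota x).
Proof.
by apply/monic_irredP; split; [exact: min_poly_monic | exact: min_poly_irreducible].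
Qed.

Lemma big_orbit (A : Type) (idx : A) (op : Monoid.com_law idx) (G : L -> A) x :
  \big[op/idx]_(z | z \in orb x) G z = \big[op/idx]_(l < ord x) G (x ^+ (q ^ l)).
Proof.
rewrite -big_uniq ?fingraph.orbit_uniq //=.
rewrite (big_nth x) fingraph.size_orbit big_mkord; apply: eq_bigr => l _.
by rewrite /fingraph.orbit nth_traject // iter_frob.
Qed.

Lemma half_order_sum d : half_order F d = (half_order F 1 * \sum_(l < d) q ^ l)%N.
Proof. by have := half_orderM q_odd 1 d; rewrite mul1n expn1. Qed.

(** The exponent (q^d - 1)/2 is (q - 1)/2 times 1 + q + ... + q^(d-1), and the second factor turns
    f(x) into the product over the conjugates of x. *)
Lemma legendre_norm (f : {poly F}) x : #|Fix (ord x)| = (q ^ ord x)%N ->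
  (legendre f (min_poly iota x))%:~R =
    (\prod_(z | z \in orb x) f^i.[z]) ^+ half_order F 1 :> L.
Proof.
move=> cx; rewrite legendreE // (quad_charE q_odd) ?fingraph.order_gt0 //; last first.
  exact: horner_Fix (Fix_ord x).
rewrite big_orbit half_order_sum mulnC exprM; congr (_ ^+ _).
rewrite -prodrXr; apply: eq_bigr => l _.
by rewrite frob_horner.
Qed.

Lemma square_free_multp (m P : {poly F}) : square_free m -> irreducible_poly P ->
  multp P m = (P %| m).
Proof.
case=> m0 sqf iP; have sP := iP.1.
have le1 : (multp P m <= 1)%N.
  rewrite leqNgt multp_geq //; apply: sqf; by rewrite neq_ltn sP orbT.
rewrite -[in RHS](expr1 P) -multp_geq //; move: le1; case: (multp P m) => [|[]] //.
Qed.

(** The roots of m are grouped by minimal polynomial, and each irreducible factor of m occurs once.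
    The map [mp] stores these polynomials in the index type of [jacobi]. *)
Lemma jacobi_norm (f m : {poly F}) : square_free m -> splits m^i ->
  (forall x, root m^i x -> #|Fix (ord x)| = (q ^ ord x)%N) ->
  (jacobi f m)%:~R = (\prod_(w | root m^i w) f^i.[w]) ^+ half_order F 1 :> L.
Proof.
move=> sqm splm cm; have m0 := sqm.1.
have m0i : m^i != 0 by rewrite map_poly_eq0.
pose mp w := npolyp (size m) (min_poly iota w).
have mpE w : root m^i w -> polyn (mp w) = min_poly iota w.
  by rewrite min_poly_dvdP => /(dvdp_leq m0) sw; rewrite npolypK.
rewrite /jacobi rmorph_prod -prodrXl /=.
rewrite [RHS](partition_big mp (fun P => monic_irred (polyn P))) /=; last first.
  by move=> w wm; rewrite mpE // min_poly_monic_irred.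
apply: eq_bigr => P iP; have [mP irP] := monic_irredP _ iP.
rewrite square_free_multp //; have [Pm|nPm] := boolP (polyn P %| m); last first.
  rewrite expr0 big_pred0 // => w; apply/negP => /andP[wm /eqP wP].
  by case/negP: nPm; rewrite -wP mpE // -min_poly_dvdP.
have [x xP] : exists x, root (polyn P)^i x.
  have [s Ps] : splits (polyn P)^i by apply: splits_dvdp splm; rewrite dvdp_map.
  case: s Ps => [|x s] Ps; last first.
    by exists x; rewrite (eqp_root Ps) root_prod_XsubC inE eqxx.
  by have := irP.1; rewrite -(size_map_poly iota) (eqp_size Ps) big_nil size_poly1.
have PE := min_poly_uniq iP xP.
have xm : root m^i x.
  by move: Pm; rewrite -(dvdp_map iota) => /dvdpP[g ->]; rewrite rootM xP orbT.
rewrite expr1 PE legendre_norm ?cm // -prodrXl; apply: eq_bigl => w.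
rewrite -root_min_poly -PE; apply/idP/andP => [wP|[wm /eqP <-]]; last first.
  by rewrite mpE // root_min_poly fingraph.in_orbit.
have wm : root m^i w.
  by move: Pm; rewrite -(dvdp_map iota) => /dvdpP[g ->]; rewrite rootM wP orbT.
split=> //; apply/eqP/val_inj; rewrite /= mpE //.
by rewrite -(min_poly_uniq iP wP).
Qed.

End Residue.

Lemma legendre_sign (F : finFieldType) (f P : {poly F}) : legendre f P \in [:: 0; 1; -1].
Proof. by rewrite /legendre; do 2!case: ifP => //. Qed.

Lemma jacobi_sign (F : finFieldType) (f m : {poly F}) : jacobi f m \in [:: 0; 1; -1].
Proof.
have signM (a b : int) : a \in [:: 0; 1; -1] -> b \in [:: 0; 1; -1] ->
    a * b \in [:: 0; 1; -1].
  by rewrite !inE => /or3P[]/eqP-> /or3P[]/eqP->.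
rewrite /jacobi; elim/big_ind: _ => // P _; elim: (multp _ _) => // k IH.
by rewrite exprS signM // legendre_sign.
Qed.

(** * The modulus T^q + T *)

Definition trace_poly (F : finFieldType) : {poly F} := 'X^#|F| + 'X.

Section TracePoly.

Variable F : finFieldType.
Local Notation q := #|F|.
Local Notation m := (trace_poly F).

Lemma size_trace_poly : size m = q.+1.
Proof. by rewrite size_polyDl size_polyXn // size_polyX ltnS finNzRing_gt1. Qed.

Lemma trace_poly_monic : m \is monic.
Proof.
rewrite monicE lead_coefDl ?lead_coefXn //.
by rewrite size_polyXn size_polyX ltnS finNzRing_gt1.
Qed.

Lemma deriv_trace_poly : m^`() = 1.
Proof.
rewrite derivD derivXn derivX -mulr_natr -polyC_natr.
by rewrite (natq0 (idfun : {rmorphism F -> F})) mulr0 add0r.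
Qed.

Lemma trace_poly_square_free : square_free m.
Proof.
split=> [|u su]; first exact: monic_neq0 trace_poly_monic.
apply/negP => /dvdpP[g mE]; have := deriv_trace_poly.
have -> : m^`() = u * (g^`() * u + g * u^`() *+ 2) by rewrite mE expr2 !derivM; ring.
move=> u1; have : u %| 1 by rewrite -u1 dvdp_mulr.
by rewrite dvdp1 (negPf su).
Qed.

Variables (L : finFieldType) (iota : {rmorphism F -> L}).
Local Notation Fix := (frob_fix F L).
Local Notation "f ^i" := (map_poly iota f) (at level 2, format "f ^i").
Local Notation frob := (frobenius iota).
Local Notation ord := (fingraph.order frob).
Local Notation orb := (fingraph.orbit frob).

Hypothesis q4 : (q %% 4 = 1)%N.

Lemma odd_of_mod4 : odd q.
Proof. by move: q4; lia. Qed.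
Local Notation q_odd := odd_of_mod4.

Variable B : nat.
Hypothesis splitB : forall f : {poly F}, f != 0 -> (size f <= B)%N -> splits f^i.
Hypothesis qqB : (q ^ q < B)%N.

Lemma trace_polyE : m^i = 'X^q + 'X.
Proof. by rewrite rmorphD /= map_polyXn map_polyX. Qed.

Lemma horner_trace_poly x : m^i.[x] = x ^+ q + x.
Proof. by rewrite trace_polyE !hornerE. Qed.

Lemma leq_q_qq : (q < q ^ q)%N.
Proof. by rewrite ltn_expl // finNzRing_gt1. Qed.

Lemma trace_poly_splits : splits m^i.
Proof.
apply: splitB; first exact: trace_poly_square_free.1.
by rewrite size_trace_poly; exact: ltn_trans leq_q_qq qqB.
Qed.

Lemma trace_poly_prod : m^i = \prod_(w | root m^i w) ('X - w%:P).
Proof.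
have sep : separable_poly m^i.
  by rewrite separable_map separable_poly.unlock deriv_trace_poly coprimep1.
have sE := card_roots trace_poly_splits sep; rewrite size_map_poly size_trace_poly /= in sE.
rewrite [LHS](@all_roots_prod_XsubC _ _ (enum [set w | root m^i w])).
- rewrite big_enum lead_coef_map (monicP trace_poly_monic) rmorph1 scale1r.
  by apply: eq_bigl => w; rewrite inE.
- by rewrite size_map_poly size_trace_poly -cardE sE.
- by apply/allP => w; rewrite mem_enum inE.
by rewrite uniq_rootsE enum_uniq.
Qed.

Lemma jacobi_trace f : (jacobi f m)%:~R =
  (\prod_(w | root m^i w) f^i.[w]) ^+ half_order F 1 :> L.
Proof.
apply: (jacobi_norm q_odd) => //; [exact: trace_poly_square_free | exact: trace_poly_splits |].
(* A root of m has degree at most q over [F], which is why q^q < B suffices. *)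
move=> x; rewrite min_poly_dvdP => /(dvdp_leq (trace_poly_square_free).1).
rewrite size_min_poly size_trace_poly ltnS => ordq.
apply: (card_Fix splitB); first exact: fingraph.order_gt0.
by apply: leq_ltn_trans qqB; rewrite leq_exp2l ?finNzRing_gt1.
Qed.

Lemma jacobiM f g : jacobi (f * g) m = jacobi f m * jacobi g m.
Proof.
apply: (sign_intr_inj iota q_odd); first exact: jacobi_sign.
  have := jacobi_sign f m; have := jacobi_sign g m.
  by rewrite !inE => /or3P[]/eqP-> /or3P[]/eqP->.
rewrite intrM !jacobi_trace -exprMn -big_split /=; congr (_ ^+ _).
by apply: eq_bigr => w _; rewrite rmorphM hornerM.
Qed.

(** This is reciprocity: both sides come from the product of the differences w - z over roots w of m
    and conjugates z of x. Reversing the differences costs only a sign, which disappears because (q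
    - 1)/2 is even. *)
Lemma jacobi_min_poly x : jacobi (min_poly iota x) m = quad_char F (ord x) (x ^+ q + x).
Proof.
apply: (sign_intr_inj iota q_odd); [exact: jacobi_sign | exact: quad_char_sign |].
have xx := Fix_ord iota x.
rewrite jacobi_trace (quad_charE q_odd) ?fingraph.order_gt0 ?(FixD iota) ?FixX //.
have -> : \prod_(w | root m^i w) (min_poly iota x)^i.[w] =
    \prod_(w | root m^i w) \prod_(z | z \in orb x) (w - z).
  apply: eq_bigr => w _; rewrite min_polyE /conj_poly horner_prod /= -big_uniq ?fingraph.orbit_uniq //=.
  by apply: eq_bigr => z _; rewrite !hornerE.
rewrite exchange_big /=.
have -> : \prod_(z | z \in orb x) \prod_(w | root m^i w) (w - z) =
    \prod_(z | z \in orb x) ((-1) ^+ #|[pred w | root m^i w]| * m^i.[z]).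
  apply: eq_bigr => z _.
  have -> : m^i.[z] = \prod_(w | root m^i w) (z - w).
    by rewrite [in LHS]trace_poly_prod horner_prod; apply: eq_bigr => w _; rewrite !hornerE.
  rewrite -prodr_const -big_split /=.
  by apply: eq_bigr => w _; rewrite mulN1r opprB.
have sgn n k : ((-1) ^+ n ^+ k) ^+ half_order F 1 = 1 :> L.
  have he : ~~ odd (half_order F 1).
    by have := half_orderE q_odd 1; rewrite expn1; move: (half_order F 1) q4 => h; lia.
  by rewrite -!exprM -signr_odd !oddM (negPf he) !andbF.
rewrite big_split /= exprMn prodr_const sgn.
rewrite mul1r big_orbit (half_order_sum q_odd (ord x)) mulnC exprM; congr (_ ^+ _).
rewrite -horner_trace_poly -prodrXr; apply: eq_bigr => l _.
by rewrite frob_horner.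
Qed.

Definition twist (f : {poly F}) : int := liouville f * jacobi f m.

Lemma twistM f g : f != 0 -> g != 0 -> twist (f * g) = twist f * twist g.
Proof. by move=> f0 g0; rewrite /twist liouvilleM // jacobiM mulrACA. Qed.

Lemma twist_min_poly x : twist (min_poly iota x) = - quad_char F (ord x) (x ^+ q + x).
Proof.
by rewrite /twist liouville_irred ?min_poly_monic_irred // jacobi_min_poly mulN1r.
Qed.

(** Multiplicativity forces this as soon as one value is nonzero; the minimal polynomial of 1
    provides one, since 1^q + 1 = 2. *)
Lemma twist1 : twist 1 = 1.
Proof.
have x0 : twist (min_poly iota 1) != 0.
  rewrite twist_min_poly oppr_eq0 /quad_char expr1n -mulr2n.
  have two0 : 1 *+ 2 != 0 :> L.
    by rewrite mulr2n addr_eq0 (oner_neqN1 iota q_odd).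
  by rewrite (negPf two0); case: ifP.
exact: (multiplicative_at1 twistM (min_poly_neq0 iota 1) x0).
Qed.

Lemma twist_sumE j : (0 < j)%N -> prime_power_sum twist iota j =
  \sum_(x in Fix j) (-1) ^+ (j %/ ord x) * quad_char F j (x ^+ q + x).
Proof.
move=> j0; apply: eq_bigr => x xj; rewrite twist_min_poly [LHS]exprNn; congr (_ * _).
have dj : (ord x %| j)%N by rewrite (order_frob_dvd iota).
rewrite -{2}(divnK dj) mulnC (quad_charX iota q_odd) ?fingraph.order_gt0 //.
  by rewrite divn_gt0 ?fingraph.order_gt0 // dvdn_leq.
by rewrite (FixD iota) ?FixX // (Fix_ord iota).
Qed.

Lemma twist_sum_odd j : odd j -> prime_power_sum twist iota j = 0.
Proof.
move=> jo; have j0 : (0 < j)%N by case: (j) jo.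
transitivity (- char_sum F L j); last by rewrite (char_sum_odd iota q_odd jo) oppr0.
rewrite twist_sumE // -sumrN.
apply: eq_bigr => x xj; rewrite -signr_odd.
have dj : (ord x %| j)%N by rewrite (order_frob_dvd iota).
by move: jo; rewrite -{1}(divnK dj) oddM => /andP[-> _]; rewrite expr1 mulN1r.
Qed.

(** The quotient 2i / [ord x] is even exactly when x lies in the field of q^i elements. So the sum
    is minus the full character sum plus twice its part over this subfield. *)
Lemma twist_sum_even i : (0 < i)%N -> (q ^ (i + i) < B)%N ->
  prime_power_sum twist iota (i + i) =
  (q%:Z - 1) * (- q%:Z) ^+ i + 2 * ((q ^ i)%N%:Z - (fixed_roots F i)%:Z).
Proof.
move=> i0 iB; have ii0 : (0 < i + i)%N by rewrite addn_gt0 i0.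
have iB' : (q ^ i < B)%N.
  by apply: leq_ltn_trans iB; rewrite leq_exp2l ?finNzRing_gt1 ?leq_addr.
have qB : (q ^ 1 < B)%N.
  by apply: leq_ltn_trans iB'; rewrite leq_exp2l ?finNzRing_gt1.
have cF2 : #|Fix (i + i)| = (q ^ (i + i))%N by apply: (card_Fix splitB).
have cF : #|Fix i| = (q ^ i)%N by apply: (card_Fix splitB).
have ck : #|alt_kernel F L| = q.
  rewrite -[RHS]expn1 -(card_root_XqaX splitB (isT : 0 < 1)%N qB (oner_neq0 F)).
  by apply: eq_card => x; rewrite !inE rmorph1 mul1r expn1.
have ct : #|twisted_fix F L i| = (q ^ i)%N.
  have a0 : - (-1) ^+ i != 0 :> F by rewrite oppr_eq0 signr_eq0.
  rewrite -(card_root_XqaX splitB i0 iB' a0).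
  by apply: eq_card => x; rewrite !inE rmorphN rmorph_sign mulNr subr_eq0.
rewrite twist_sumE //.
rewrite (eq_bigr (fun x => - quad_char F (i + i) (x ^+ q + x) +
   2 * (if x \in Fix i then quad_char F (i + i) (x ^+ q + x) else 0))); last first.
  move=> x; rewrite -!(order_frob_dvd iota) => dx.
  have d0 : (0 < ord x)%N by rewrite fingraph.order_gt0.
  have [di|ndi] := boolP (ord x %| i)%N.
    rewrite -signr_odd divnDl // oddD addbb mul1r; ring.
  rewrite mulr0 addr0 -signr_odd.
  suff -> : odd ((i + i) %/ ord x) by rewrite expr1 mulN1r.
  apply: contraR ndi; rewrite -dvdn2 => /dvdnP[k kE].
  have := divnK dx; rewrite kE => e; apply/dvdnP; exists k.
  by move: (ord x) e => d e; nia.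
rewrite big_split /= -mulr_sumr sumrN -/(char_sum F L (i + i)).
rewrite (char_sum_even iota q_odd q4 i0 ct cF2 cF ck) mulNr opprK; congr (_ + 2 * _).
rewrite -(char_sum_subfield iota q_odd cF ck) -big_mkcondr /=.
apply: eq_bigl => x; apply: andb_idl => xi.
by rewrite -(order_frob_dvd iota) dvdn_add // (order_frob_dvd iota).
Qed.

End TracePoly.

(** * Signs of the coefficients *)

Section Recursion.

(** The coefficient form of v U'(v) = E(v) U(v), so [e] lists the coefficients of v U'/U. *)
Definition newton_rel (e u : nat -> int) :=
  forall n, n%:Z * u n = \sum_(1 <= i < n.+1) e i * u (n - i)%N.

(** In the recursion the last term e(n) u(0) already exceeds n, and by induction the other terms are
    nonnegative. *)
Lemma newton_gt1 (e u : nat -> int) : newton_rel e u -> u 0%N = 1 ->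
  (forall i, (0 < i)%N -> i%:Z < e i) -> forall n, (0 < n)%N -> 1 < u n.
Proof.
move=> rec u0 egt n; elim/ltn_ind: n => n IH n0.
have u1 i : (i < n)%N -> 1 <= u i.
  by case: i => [|i] lin; [rewrite u0 | apply/ltW/IH].
have : n%:Z < n%:Z * u n.
  rewrite rec big_nat_recr //= subnn u0 mulr1 -[ltLHS]add0r ler_ltD ?egt //.
  rewrite big_nat_cond; apply: sumr_ge0 => i /andP[/andP[i0 lin] _].
  apply: mulr_ge0; first exact: ltW (lt_trans _ (egt i i0)).
  by apply: le_trans (u1 _ _); rewrite // ltn_subrL i0.
by rewrite -[X in X < _]mulr1 ltr_pM2l // ltz_nat.
Qed.

(** Dividing a series by 1 - v adds v/(1 - v) to v U'/U, that is, 1 to each coefficient. *)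
Lemma newton_partial_sums (e u : nat -> int) : newton_rel e u ->
  newton_rel (fun i => e i + 1) (fun n => \sum_(i < n.+1) u i).
Proof.
move=> rec; elim=> [|n IH]; first by rewrite mul0r big_geq.
pose s n := \sum_(i < n.+1) u i.
have sS k : s k.+1 = s k + u k.+1 by rewrite /s big_ord_recr.
rewrite -/(s _) big_nat_recr //= subnn.
have -> : \sum_(1 <= i < n.+1) (e i + 1) * \sum_(l < (n.+1 - i).+1) u l =
    \sum_(1 <= i < n.+1) (e i + 1) * s (n - i)%N +
    \sum_(1 <= i < n.+1) (e i * u (n.+1 - i)%N + u (n.+1 - i)%N).
  rewrite -big_split /=; apply: eq_big_nat => i /andP[i0 lin].
  by rewrite -/(s _) subSn // sS mulrDr; ring.
rewrite -[\sum_(1 <= i < n.+1) (e i + 1) * s _]IH -/(s n).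
have sE : \sum_(1 <= i < n.+2) u (n.+1 - i)%N = s n.
  rewrite /s -(big_mkord predT) big_add1 /= big_nat_rev /=.
  by apply: eq_big_nat => i /andP[_ lin]; congr u; lia.
rewrite big_nat_recr //= subnn in sE.
have r := rec n.+1; rewrite big_nat_recr //= subnn in r.
rewrite big_split /= -/(s n.+1) sS big_ord1 mulrDr r.
have -> : n.+1%:Z = n%:Z + 1 by lia.
rewrite (_ : u (@ord0 0) = u 0%N) //; rewrite -sE; ring.
Qed.

Lemma newton_sign (e u : nat -> int) : newton_rel e u ->
  newton_rel (fun i => (-1) ^+ i * e i) (fun n => (-1) ^+ n * u n).
Proof.
move=> rec n; rewrite mulrCA rec mulr_sumr; apply: eq_big_nat => i /andP[_ lin].
rewrite mulrACA -exprD subnKC //.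
Qed.

Lemma sum_even_terms (G : nat -> int) n : (forall j, odd j -> G j = 0) ->
  \sum_(1 <= j < n.+1) G j = \sum_(1 <= i < (n./2).+1) G (i + i)%N.
Proof.
move=> G0; elim: n => [|n IH]; first by rewrite !big_geq.
rewrite big_nat_recr //= IH -/(uphalf n) uphalf_half.
have [no|ne] := boolP (odd n).
  rewrite add1n [RHS]big_nat_recr //=; congr (_ + G _).
  by rewrite -[in LHS](odd_double_half n) no addnn doubleS.
by rewrite add0n G0 ?addr0 //= ne.
Qed.

End Recursion.

Section Coefficients.

Variable F : finFieldType.
Local Notation q := #|F|.
Local Notation m := (trace_poly F).
Hypothesis q4 : (q %% 4 = 1)%N.

Local Notation g n := (monic_sum (@twist F) n).

(* Coefficient of v^j in v H'(v) / H(v), where H is the generating series of the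
   differences a_+ - a_- in the variable v = u^2. *)
Definition log_coef (j : nat) : int :=
  (q./2)%N%:Z * (- q%:Z) ^+ j + (q ^ j)%N%:Z - (fixed_roots F j)%:Z.

(** The factor 2 comes from v = u^2, as u d/du = 2 v d/dv. *)
Definition twist_sum (j : nat) : int := if odd j then 0 else 2 * log_coef j./2.

Lemma newton_twist : newton_rel twist_sum (fun n => g n).
Proof.
(* The bound covers the polynomials of degree n, the fields of q^j elements for j <= n, and the
   condition q^q < B. The field [L] may vary with n, since the relation does not mention it. *)
move=> n; have [L [iota splitB]] := splitting_extension F (q ^ (n + q)).+1.
have q1 : (1 < q)%N := finNzRing_gt1 F.
have qqB : (q ^ q < (q ^ (n + q)).+1)%N by rewrite ltnS leq_exp2l // leq_addl.
rewrite (newton (twistM q4 splitB qqB) (iota := iota)).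
- apply: eq_big_nat => j /andP[j0 jn]; congr (_ * _).
  rewrite /twist_sum; case: ifPn => jo; first exact: (twist_sum_odd q4 splitB).
  have jE : j = (j./2 + j./2)%N by rewrite addnn even_halfK.
  rewrite [in LHS]jE (twist_sum_even q4 splitB qqB); first last.
  - by rewrite -jE ltnS leq_exp2l // -ltnS (leq_trans jn) // ltnS leq_addr.
  - by move: j0 jE; case: (j./2) => // j0 jE; move: j0; rewrite jE.
  rewrite /log_coef; have : q%:Z - 1 = 2 * (q./2)%N%:Z.
    by have := odd_double_half q; rewrite (odd_of_mod4 q4); lia.
  by move=> ->; ring.
- exact: (twist1 q4 splitB qqB).
move=> f f0 sf; apply: splitB => //; apply: leq_trans sf _.
rewrite ltnS; apply: leq_trans (ltnW (ltn_expl n q1)) _.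
by rewrite leq_exp2l // leq_addr.
Qed.

Lemma twist_coef_odd n : odd n -> g n = 0.
Proof.
elim/ltn_ind: n => n IH no; have n0 : n%:Z != 0 by case: (n) no.
apply: (mulfI n0); rewrite mulr0 newton_twist big_nat_cond big1 // => i.
rewrite andbT ltnS => /andP[i0 lin]; rewrite /twist_sum; case: ifPn => io.
  by rewrite mul0r.
rewrite IH ?mulr0 ?ltn_subrL ?i0 ?(leq_trans i0 lin) //.
by rewrite oddB // no (negPf io).
Qed.

Lemma newton_even : newton_rel log_coef (fun j => g (j + j)%N).
Proof.
move=> n; apply: (mulfI (isT : 2 != 0 :> int)); rewrite mulrA.
have -> : 2 * n%:Z = (n + n)%N%:Z by lia.
rewrite newton_twist sum_even_terms => [|j jo]; last by rewrite /twist_sum jo mul0r.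
rewrite addnn doubleK mulr_sumr; apply: eq_big_nat => i /andP[_ lin].
rewrite /twist_sum addnn odd_double doubleK -mulrA -doubleB -addnn.
by rewrite addnn.
Qed.

Lemma twist_coef0 : g 0 = 1.
Proof.
have [L [iota splitB]] := splitting_extension F (q ^ q).+1.
by apply: monic_sum0; apply: (twist1 q4 splitB).
Qed.

(** Put k = (q - 1)/2 >= 2 and Q = q^i > i. The two quantities are (k + 1) Q - q and (k + 1) Q - q +
    1 for even i, and (k - 1) Q + 1 and (k - 1) Q for odd i. *)
Lemma log_coef_sign i : (0 < i)%N ->
  i%:Z < (-1) ^+ i * log_coef i /\ i%:Z < (-1) ^+ i * (log_coef i + 1).
Proof.
move=> i0; have q1 : (1 < q)%N := finNzRing_gt1 F.
have iq : (i < q ^ i)%N by rewrite ltn_expl.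
have q5 : (5 <= q)%N by move: q1 q4; lia.
have qi : (q <= q ^ i)%N by rewrite -{1}[q]expn1 leq_exp2l.
have Nq : (- q%:Z) ^+ i = (-1) ^+ odd i * (q ^ i)%N%:Z.
  by rewrite signr_odd [LHS]exprNn -[Posz (q ^ i)]natz natrX natz.
rewrite /log_coef /fixed_roots Nq -(signr_odd _ i).
have k2 : (2 <= q./2)%N by lia.
have kq : (q./2.*2.+1 = q)%N by have := odd_double_half q; rewrite (odd_of_mod4 q4).
move: (q ^ i)%N iq qi => Q iq qi; case: (odd i); rewrite ?expr1 ?expr0; split; nia.
Qed.

Lemma twist_coef_even j : (-1) ^+ j * g (j + j)%N >= 1.
Proof.
case: j => [|j]; first by rewrite mul1r twist_coef0.
apply: ltW; apply: (newton_gt1 (newton_sign newton_even)) => //.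
  by rewrite mul1r twist_coef0.
by move=> i /log_coef_sign[].
Qed.

(** Strictness matters: [A_lambda] starts in degree 1, so the constant coefficient 1 is subtracted
    from this sum. *)
Lemma twist_partial_sum j : (0 < j)%N ->
  1 < (-1) ^+ j * \sum_(i < j.+1) g (i + i)%N.
Proof.
apply: (newton_gt1 (newton_sign (newton_partial_sums newton_even))).
  by rewrite big_ord1 mul1r twist_coef0.
by move=> i /log_coef_sign[].
Qed.

Lemma twist_sign f : twist (F := F) f \in [:: 0; 1; -1].
Proof.
rewrite /twist /liouville -signr_odd; have := jacobi_sign f m.
by rewrite !inE => /or3P[]/eqP->; case: (odd _).
Qed.

Lemma a_lambda_diff n :
  (a_lambda 1 n m)%:Z - (a_lambda (-1) n m)%:Z = g n.
Proof.
have aE s : (a_lambda s n m)%:Z =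
    \sum_(f : {poly_(n.+1) F} | monic_deg n (polyn f)) (twist (polyn f) == s)%:R.
  rewrite /a_lambda -sum1dep_card -natz natr_sum big_mkcond [RHS]big_mkcond /=.
  apply: eq_bigr => f _; rewrite /monic_deg /twist.
  by case: (_ \is _); case: (_ == _); case: (_ == _).
rewrite !aE -sumrB; apply: eq_bigr => f _.
by have := twist_sign (polyn f); rewrite !inE => /or3P[]/eqP->.
Qed.

Lemma A_lambda_diff n :
  (A_lambda 1 n m)%:Z - (A_lambda (-1) n m)%:Z =
  \sum_(i < (n./2).+1) g (i + i)%N - 1.
Proof.
rewrite /A_lambda -!natz !natr_sum -sumrB.
under eq_bigr do rewrite !natz a_lambda_diff.
rewrite sum_even_terms => [|j jo]; last exact: twist_coef_odd.
rewrite -(big_mkord predT (fun i => g (i + i)%N)) [in RHS]big_ltn //.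
have -> : g (0 + 0) = 1 := twist_coef0.
by rewrite addrC addKr.
Qed.

Lemma a_lambda_lt n : (a_lambda (-1) n m < a_lambda 1 n m)%N = (4 %| n)%N.
Proof.
rewrite -ltz_nat -subr_gt0 a_lambda_diff; have [no|ne] := boolP (odd n).
  rewrite twist_coef_odd // ltxx; apply/esym/negP => /dvdnP[k nE].
  by move: no; rewrite nE oddM andbF.
have := twist_coef_even n./2; rewrite addnn even_halfK // -signr_odd.
have -> : (4 %| n)%N = ~~ odd n./2.
  rewrite -[in LHS](even_halfK ne) -muln2 -[4%N]/(2 * 2)%N dvdn_pmul2r //.
  by rewrite dvdn2.
by case: (odd n./2) => /=; rewrite ?expr1 ?expr0; move: (g n) => x; lia.
Qed.

(** Positivity means that [n./2] is even and nonzero; for n <= 1 the two counts are equal. *)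
Lemma A_lambda_lt n : (A_lambda (-1) n m < A_lambda 1 n m)%N =
  (3 < n)%N && (n %% 4 < 2)%N.
Proof.
rewrite -ltz_nat -subr_gt0 A_lambda_diff subr_gt0; have [n1|n1] := leqP n 1.
  have -> : n./2 = 0%N by case: n n1 => [|[]].
  by rewrite big_ord1 twist_coef0 ltxx; case: n n1 => [|[]].
have /twist_partial_sum : (0 < n./2)%N by rewrite half_gt0.
move: (\sum_(_ < _) _) => S; rewrite -signr_odd.
have -> : (3 < n)%N && (n %% 4 < 2)%N = ~~ odd n./2 by lia.
by case: (odd n./2); rewrite ?expr1 ?expr0; lia.
Qed.

End Coefficients.

(** * Densities *)

Lemma has_density_bounded (R : realType) (E : nat -> bool) (d C : R) :
  (forall n, `|(count E (iota 1 n))%:R - d * n%:R| <= C) -> has_density E d.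
Proof.
move=> dC; apply/cvgrPdist_le => e e0.
near=> n; have n0 : 0 < n%:R :> R.
  by rewrite ltr0n; near: n; exact: nbhs_infty_gt.
have Cn : C <= e * n%:R.
  by rewrite mulrC -ler_pdivrMr //; near: n; exact: nbhs_infty_ger.
have -> : d - (count E (iota 1 n))%:R / n%:R =
    - (((count E (iota 1 n))%:R - d * n%:R) / n%:R).
  by rewrite mulrBl mulfK ?gt_eqF // opprB.
by rewrite normrN normf_div (gtr0_norm n0) ler_pdivrMr // (le_trans (dC n)).
Unshelve. all: by end_near. Qed.

Theorem corollary4p7 (R : realType) (p r q : nat) (F : finFieldType)
    (hp : prime p) (hodd : odd p) (hr : (0 < r)%N) (hq : q = (p ^ r)%N)
    (hF : #|F| = q) (hq4 : (q %% 4)%N = 1%N)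
    (eps : R) (heps : 0 < eps) :
  exists m : {poly F},
    [/\ m \is monic, square_free m, (1 < size m)%N &
      exists dnc d : R,
        [/\ has_delta_plus_nc m dnc, has_delta_plus m d,
            dnc < 1 / 2 + eps & d < 1 / 2 + eps]].
Proof.
have q4 : (#|F| %% 4)%N = 1%N by rewrite hF.
exists (trace_poly F); split.
- exact: trace_poly_monic.
- exact: trace_poly_square_free.
- by rewrite size_trace_poly ltnS card_finField_gt0.
exists (1 / 4), (1 / 2); split; [| | lra | lra].
- apply: (@has_density_bounded _ _ _ 1) => n.
  rewrite (eq_count (a_lambda_lt q4)).
  have cE : count (dvdn 4) (iota 1 n) = (n %/ 4)%N.
    elim: n => // n IH; rewrite -[in iota _ _](addn1 n) iotaD count_cat IH /= add1n addn0; lia.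
  rewrite cE ler_norml; have := divn_eq n 4; have := ltn_pmod n (isT : 0 < 4)%N.
  move: (n %/ 4)%N (n %% 4)%N => a b; rewrite -(ltr_nat R) => b4 /(congr1 (fun k => k%:R : R)).
  rewrite natrD natrM => ->; have := ler0n R b; move: b4; lra.
apply: (@has_density_bounded _ _ _ 4) => n.
rewrite (eq_count (A_lambda_lt q4)).
(* The right-hand argument of [maxn] counts the k from 0 to n that are 0 or 1 modulo 4. The 2
   accounts for k = 0 and k = 1, and [maxn] corrects the case n = 0. *)
have cE : (count (fun k => (3 < k) && (k %% 4 < 2)) (iota 1 n) + 2 =
    maxn 2 ((n %/ 4).*2 + minn (n %% 4).+1 2))%N.
  elim: n => // n IH; rewrite -[in iota _ _](addn1 n) iotaD count_cat /= add1n addn0 addnAC IH; lia.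
have : (2 * count (fun k => (3 < k) && (k %% 4 < 2)) (iota 1 n) <= n + 4)%N by lia.
have : (n <= 2 * count (fun k => (3 < k) && (k %% 4 < 2)) (iota 1 n) + 8)%N by lia.
move: (count _ _) => c; rewrite -!(ler_nat R) !natrD ler_norml; lra.
Qed.
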